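(* Let $A\in\mathbb{R}_{\max}^{d\times d}$ be irreducible. Denote by $\gamma$ the cyclicity of $\mathcal{G}(A)$ and by $\hat g$ the maximal girth of the strongly connected components of the critical graph $\mathcal{G}^c(A)$. Then the following upper bounds hold: (i) $T_{1,\mathrm{N}}(A)\le \gamma\cdot \mathrm{Wi}\left(\left\lfloor \frac{d}{\gamma}\right\rfloor\right)+(d \operatorname{rem}\gamma)$; (ii) $T_{1,\mathrm{N}}(A)\le \hat g\cdot\left(\left\lfloor \frac{d}{\gamma}\right\rfloor-2\right)+d$.
   Context: Max-plus algebra: $\mathbb{R}_{\max}=\mathbb{R}\cup\{-\infty\}$ with $a\oplus b=\max(a,b)$ and $a\otimes b=a+b$, extended to matrices by $(A\oplus B)_{ij}=a_{ij}\oplus b_{ij}$ and $(AB)_{ij}=(A\otimes B)_{ij}=\bigoplus_k a_{ik}\otimes b_{kj}$. $A^t$ is the $t$-th max-plus power, $A^0=I$ (entries $0$ on the diagonal, $-\infty$ elsewhere); $\lambda^{\otimes t}=t\lambda$ for a scalar, and scalar multiplication $\mu\otimes A$ adds $\mu$ to every entry. Graphs: $\mathcal{G}(A)$ is the weighted digraph with nodes $1,\dots,d$ and an arc $(i,j)$ of weight $a_{ij}$ whenever $a_{ij}\ne-\infty$. A cycle is a closed walk with at least one arc and no repeated node other than its coinciding ends; length is the number of arcs. $A$ is irreducible if $\mathcal{G}(A)$ is strongly connected; the $1\times1$ matrix $(-\infty)$ is excluded, so that the maximum cycle mean $\lambda(A)$ (the maximum over all cycles of $\mathcal{G}(A)$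 of weight divided by length) is finite. The critical graph $\mathcal{G}^c(A)$ consists of all nodes and arcs of cycles with mean weight $\lambda(A)$; it is a disjoint union of strongly connected components with no arcs between them. The girth of a strongly connected digraph is the smallest length of a cycle in it. The cyclicity of a strongly connected digraph is the gcd of the lengths of its cycles; the cyclicity of a disjoint union of strongly connected components is the lcm of the cyclicities of the components. CSR terms: let $\sigma$ be the cyclicity of $\mathcal{G}^c(A)$ and $M=\left(((-\lambda(A))\otimes A)^{\sigma}\right)^*$, where $N^*=\bigoplus_{i\ge0}N^i$. Define $d\times d$ matrices $C,S,R$ by: $c_{ij}=m_{ij}$ if $j$ is a node of $\mathcal{G}^c(A)$ and $-\infty$ otherwise; $r_{ij}=m_{ij}$ if $i$ is a node of $\mathcal{G}^c(A)$ and $-\infty$ otherwise; $s_{ij}=a_{ij}-\lambda(A)$ if $(i,j)$ is an arc of $\mathcal{G}^c(A)$ and $-\infty$ otherwise. $CS^tR$ is the max-plus product (with $S^0=I$). Nachtigall scheme: $B_{\mathrm{N}}[A]$ is the matrix with entries $-\infty$ at $(i,j)$ if $i$ or $j$ is a node of $\mathcal{G}^c(A)$, and $a_{ij}$ otherwise. $T_{1,\mathrm{N}}(A)$ is the smallest nonnegative integer $T$ such that $A^t=\left(\lambda(A)^{\otimes t}\otimes CS^tR\right)\oplus (B_{\mathrm{N}}[A])^t$ for all $t\ge T$. $\mathrm{Wi}(n)=(n-1)^2+1$ if $n>1$ and $\mathrm{Wi}(1)=0$. $d\operatorname{rem}\gamma$ is the remainder of the Euclidean division of $d$ by $\gamma$.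 *)

(* Defs.v *)
From HB Require Import structures.
From mathcomp Require Import all_boot all_order all_algebra.
From mathcomp Require Import boolp classical_sets reals.

Set Implicit Arguments.
Unset Strict Implicit.
Unset Printing Implicit Defensive.

Import Order.TTheory GRing.Theory Num.Theory.
Local Open Scope ring_scope.

(* R_max as [option R], with [None] standing for -oo.  It is made into a
   commutative semiring whose addition [+] is the maximum and whose
   multiplication [*] is the real addition; hence the semiring constants are
   [0] = -oo and [1] = [Fin 0].  The library operations on matrices over a
   semiring ([+], [*m], [*:], [^+]) are then the max-plus ones, and [A ^+ 0]
   is the max-plus identity matrix. *)
Definition rmax (R : realType) : Type := option R.

Section RMax.
Variable R : realType.

HB.instance Definition _ := Choice.copy (rmax R) (option R).

Definition Fin (x : R) : rmax R := Some x.
Definition NInf : rmax R := None.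

Definition rmax_add (x y : rmax R) : rmax R :=
  match x, y with
  | None, _ => y
  | _, None => x
  | Some a, Some b => Fin (Num.max a b)
  end.

Definition rmax_mul (x y : rmax R) : rmax R :=
  match x, y with
  | Some a, Some b => Fin (a + b)
  | _, _ => NInf
  end.

Fact rmax_addA : associative rmax_add.
Proof. by case=> [x|] [y|] [z|] //=; rewrite maxA. Qed.

Fact rmax_addC : commutative rmax_add.
Proof. by case=> [x|] [y|] //=; rewrite maxC. Qed.

Fact rmax_add0 : left_id NInf rmax_add.
Proof. by case. Qed.

Fact rmax_mulA : associative rmax_mul.
Proof. by case=> [x|] [y|] [z|] //=; rewrite addrA. Qed.

Fact rmax_mulC : commutative rmax_mul.
Proof. by case=> [x|] [y|] //=; rewrite addrC. Qed.

Fact rmax_mul1 : left_id (Fin 0) rmax_mul.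
Proof. by case=> [x|] //=; rewrite add0r. Qed.

Fact rmax_mulDl : left_distributive rmax_mul rmax_add.
Proof. by case=> [x|] [y|] [z|] //=; rewrite addr_maxl. Qed.

Fact rmax_mul0 : left_zero NInf rmax_mul.
Proof. by []. Qed.

Fact rmax_1neq0 : Fin 0 != NInf.
Proof. by []. Qed.

HB.instance Definition _ :=
  GRing.isNmodule.Build (rmax R) rmax_addA rmax_addC rmax_add0.
HB.instance Definition _ :=
  GRing.Nmodule_isComNzSemiRing.Build (rmax R)
    rmax_mulA rmax_mulC rmax_mul1 rmax_mulDl rmax_mul0 rmax_1neq0.

(* Supremum in R_max of a set that is bounded above in R; on other sets the
   value is irrelevant. *)
Definition rmax_sup (E : set (rmax R)) : rmax R :=
  let F := [set x : R | E (Fin x)]%classic in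
  if `[< F !=set0 >]%classic then Fin (sup F) else NInf.

(* The real number underlying a finite element; [0] at -oo is a default. *)
Definition rval (x : rmax R) : R := if x is Some a then a else 0.

End RMax.

Arguments NInf {R}.

(* A digraph is given by its arc relation on a finite type of nodes. *)
Section Digraphs.
Variables (T : finType) (e : rel T).

(* [c] lists the nodes of the cycle once each, in order; its arcs are the pairs
   [(i, next c i)] for [i \in c], and its length is [size c]. *)
Definition elem_cycle (c : seq T) : bool := (c != [::]) && ucycleb e c.

Definition strongly_connected : Prop := forall i j : T, connect e i j.

Definition scc (i : T) : {set T} := [set j | connect e i j && connect e j i].

Definition has_cycle_len (K : {set T}) (n : nat) : bool :=
  [exists c : n.-tuple T, elem_cycle c && all [in K] c].

(* Cycles have length at most [#|T|], so the ranges below miss none. *)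
Definition girth (K : {set T}) : nat :=
  \big[minn/#|T|]_(n < #|T|.+1 | has_cycle_len K n) n.

Definition scc_cyclicity (K : {set T}) : nat :=
  \big[gcdn/0%N]_(n < #|T|.+1 | has_cycle_len K n) n.

End Digraphs.

Section CSR.
Variables (R : realType) (d : nat).
Implicit Types A N : 'M[rmax R]_d.

Definition arc A : rel 'I_d := fun i j => A i j != NInf.

Definition irreducible A : Prop :=
  strongly_connected (arc A) /\ ~ (d = 1%N /\ forall i j, A i j = NInf).

Definition graph_cyclicity A : nat := scc_cyclicity (arc A) [set: 'I_d].

Definition cycle_mean A (c : seq 'I_d) : R :=
  (\sum_(i <- c) rval (A i (next c i))) / (size c)%:R.

(* There are finitely many cycles, so the supremum is a maximum as soon as
   there is at least one. *)
Definition max_cycle_mean A : R :=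
  sup [set x | exists2 c, elem_cycle (arc A) c & x = cycle_mean A c]%classic.

Definition critical_cycle A (c : seq 'I_d) : Prop :=
  elem_cycle (arc A) c /\ cycle_mean A c = max_cycle_mean A.

Definition crit_nodes A : {set 'I_d} :=
  [set i | `[< exists2 c, critical_cycle A c & i \in c >]].

Definition crit_arc A : rel 'I_d := fun i j =>
  `[< exists2 c, critical_cycle A c & i \in c /\ j = next c i >].

Definition crit_components A : {set {set 'I_d}} :=
  [set scc (crit_arc A) i | i in crit_nodes A].

Definition crit_cyclicity A : nat :=
  \big[lcmn/1%N]_(K in crit_components A) scc_cyclicity (crit_arc A) K.

Definition max_crit_girth A : nat :=
  \max_(K in crit_components A) girth (crit_arc A) K.

Definition kleene_star N : 'M[rmax R]_d :=
  \matrix_(i, j) rmax_sup [set x | exists k : nat, x = (N ^+ k) i j]%classic.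

Definition normalized A : 'M[rmax R]_d := Fin (- max_cycle_mean A) *: A.

Definition csrM A : 'M[rmax R]_d :=
  kleene_star (normalized A ^+ crit_cyclicity A).

Definition csrC A : 'M[rmax R]_d :=
  \matrix_(i, j) if j \in crit_nodes A then csrM A i j else NInf.

Definition csrR A : 'M[rmax R]_d :=
  \matrix_(i, j) if i \in crit_nodes A then csrM A i j else NInf.

Definition csrS A : 'M[rmax R]_d :=
  \matrix_(i, j) if crit_arc A i j then normalized A i j else NInf.

Definition csr A (t : nat) : 'M[rmax R]_d := csrC A *m csrS A ^+ t *m csrR A.

Definition nachtigall A : 'M[rmax R]_d :=
  \matrix_(i, j)
    if (i \in crit_nodes A) || (j \in crit_nodes A) then NInf else A i j.

Definition weak_csr_from A (T : nat) : Prop := forall t : nat, (T <= t)%N ->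
  A ^+ t = Fin (max_cycle_mean A) ^+ t *: csr A t + nachtigall A ^+ t.

(* [T] is T_{1,N}(A).  A relation is used because the minimum of an empty set
   of thresholds would have no meaningful value. *)
Definition is_T1N A (T : nat) : Prop :=
  weak_csr_from A T /\ forall T' : nat, weak_csr_from A T' -> (T <= T')%N.

End CSR.

Definition Wi (n : nat) : nat := if (1 < n)%N then ((n - 1) ^ 2 + 1)%N else 0%N.

(* Main.v *)
Require Import Defs.
From mathcomp Require Import all_boot all_order all_algebra.
From mathcomp Require Import reals.
From mathcomp Require Import boolp zify ring lra.

Set Implicit Arguments.
Unset Strict Implicit.
Unset Printing Implicit Defensive.

Import Order.TTheory GRing.Theory Num.Theory.
Local Open Scope ring_scope.

(* After subtracting the maximum cycle mean, closed walks have weight <= 0 and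
   critical closed walks have weight 0.  An entry of A^t is the largest weight of
   a walk of length t; such a walk either avoids the critical nodes and is counted
   by the Nachtigall term, or it is dominated by the CSR term.  Conversely the CSR
   term is a supremum of weights of walks W that may be taken through a critical
   cycle Z of minimal length l in its component, with length = t modulo l, so one
   has to produce from W a walk of length exactly t.

   Bound (ii): among such walks take one of minimal length n.  If n <= t, copies
   of Z fill the gap.  Otherwise each node is visited at most l / gamma times,
   plus once more if it is off Z, as further visits would create
   removable closed walks of total length divisible by l.  Counting the positions
   of the walk that lie in a small cyclicity class contradicts n > t.

   Bound (i) follows from the proof of (ii) unless l = gamma * floor(d / gamma).
   Then some cyclicity class lies entirely on Z, and observing the walk every
   gamma steps gives a walk on a Hamiltonian cycle of length q = l / gamma.  Its
   arcs off that cycle carry excesses in Z/q; deleting zero-sum subfamilies leaves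
   at most q - 2 arcs, or q - 1 arcs of equal excess, which may all be replaced by
   the heaviest of them. *)

(* [path.arc] would hide the arc relation of a matrix. *)
Local Notation arc := Defs.arc.

(** * Weighted walks *)

Section Walks.
Variables (R : realType) (T : finType).
Implicit Types (e : rel T) (a : T -> T -> R) (i j k x y : T) (n m : nat).

Definition walk e a i j n (w : R) : Prop :=
  exists f : nat -> T, [/\ f 0%N = i, f n = j,
    forall p, (p < n)%N -> e (f p) (f p.+1) &
    w = \sum_(0 <= p < n) a (f p) (f p.+1)].

Lemma sum_shift (F : nat -> R) n m :
  \sum_(n <= p < n + m) F p = \sum_(0 <= p < m) F (p + n)%N.
Proof. by rewrite -[X in index_iota X _]add0n big_addn addKn. Qed.

Lemma walk0 e a i : walk e a i i 0 0.
Proof. by exists (fun=> i); split => //; rewrite big_geq. Qed.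

Lemma walk1 e a i j : e i j -> walk e a i j 1 (a i j).
Proof.
move=> eij; exists (fun p => if p is 0%N then i else j); split => //.
  by case.
by rewrite big_nat1.
Qed.

Lemma itinerary_cat e a i j k n m w v :
  walk e a i j n w -> walk e a j k m v ->
  exists f : nat -> T, [/\ f 0%N = i, f n = j, f (n + m)%N = k,
    forall p, (p < n + m)%N -> e (f p) (f p.+1) &
    w + v = \sum_(0 <= p < n + m) a (f p) (f p.+1)].
Proof.
move=> [f [f0 fn fe ->]] [g [g0 gm ge ->]].
exists (fun p => if (p <= n)%N then f p else g (p - n)%N); split.
- by rewrite f0.
- by rewrite leqnn.
- case: leqP; last by rewrite addKn.
  by rewrite -{2}[n]addn0 leq_add2l leqn0 => /eqP m0; rewrite m0 addn0 fn -g0 -gm m0.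
- move=> p; case: (ltngtP p n) => [lpn|lnp|->] lpm.
  + exact: fe.
  + by rewrite subSn ?(ltnW lnp)//; apply: ge; lia.
  + by rewrite subSnn fn -g0; apply: ge; lia.
rewrite [RHS](big_cat_nat (n := n)) ?leq_addr //=; congr (_ + _).
  by apply: eq_big_nat => p /andP[_ lpn]; rewrite (ltnW lpn) lpn.
rewrite [RHS]sum_shift; apply: eq_big_nat => p _.
rewrite addnK subSn ?leq_addl // addnK.
case: p => [|p]; last by rewrite !ifF //; apply/negbTE; lia.
by rewrite add0n leqnn ltnn fn g0.
Qed.

Lemma walk_cat e a i j k n m w v :
  walk e a i j n w -> walk e a j k m v -> walk e a i k (n + m) (w + v).
Proof.
by move=> W1 W2; have [f [f0 _ fn fe wE]] := itinerary_cat W1 W2; exists f.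
Qed.

Lemma subwalk e a (f : nat -> T) n u v :
  (forall p, (p < n)%N -> e (f p) (f p.+1)) -> (u <= v)%N -> (v <= n)%N ->
  walk e a (f u) (f v) (v - u) (\sum_(u <= p < v) a (f p) (f p.+1)).
Proof.
move=> fe luv lvn; exists (fun p => f (p + u)%N); split.
- by rewrite add0n.
- by rewrite subnK.
- by move=> p lp; apply: fe; lia.
by rewrite -{1}(subnKC luv) sum_shift.
Qed.

(* [f p] is the node and [c p] the weight accumulated after [p] steps. *)
Lemma walk_cat_split e a i j k n m w v :
  walk e a i j n w -> walk e a j k m v ->
  exists (f : nat -> T) (c : nat -> R),
    [/\ f 0%N = i /\ f n = j, f (n + m)%N = k, c 0%N = 0, c (n + m)%N = w + v &
     forall p r, (p <= r)%N -> (r <= n + m)%N ->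
       walk e a (f p) (f r) (r - p) (c r - c p)].
Proof.
move=> W1 W2; have [f [f0 fn fnm fe ->]] := itinerary_cat W1 W2.
exists f, (fun u => \sum_(0 <= p < u) a (f p) (f p.+1)); split => //.
  by rewrite big_geq.
move=> p r lpr lrn.
by rewrite (big_cat_nat (n := p)) //= addrAC subrr add0r; exact: subwalk fe lpr lrn.
Qed.

Lemma walk_mono e a e' a' i j n w :
  (forall x y, e x y -> e' x y /\ a' x y = a x y) ->
  walk e a i j n w -> walk e' a' i j n w.
Proof.
move=> H [f [f0 fn fe ->]]; exists f; split => //.
  by move=> p /fe /H [].
by apply: eq_big_nat => p /andP[_ /fe /H [_ ->]].
Qed.

Lemma walk_rep e a i n w m : walk e a i i n w -> walk e a i i (m * n) (w *+ m).
Proof.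
move=> Hw; elim: m => [|m IH]; first by rewrite mul0n mulr0n; exact: walk0.
by rewrite mulSn mulrS; exact: walk_cat Hw IH.
Qed.

Lemma walkSl e a i j n w : walk e a i j n.+1 w ->
  exists k v, [/\ e i k, walk e a k j n v & w = a i k + v].
Proof.
move=> [f [f0 fn fe ->]]; exists (f 1%N), (\sum_(0 <= p < n) a (f p.+1) (f p.+2)).
split.
- by rewrite -f0; apply: fe.
- by exists (fun p => f p.+1); split => // p lp; apply: fe.
by rewrite big_nat_recl //= f0.
Qed.

Lemma path_walk e a i s : path e i s -> exists w, walk e a i (last i s) (size s) w.
Proof.
elim: s i => [|k s IH] i /=; first by move=> _; exists 0; exact: walk0.
move=> /andP[eik /IH[w Hw]]; exists (a i k + w).
by rewrite -add1n; exact: walk_cat (walk1 a eik) Hw.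
Qed.

Lemma connect_walk e a i j : connect e i j -> exists n w, walk e a i j n w.
Proof.
by move=> /connectP[s /(path_walk a)[w Hw] ->]; exists (size s), w.
Qed.

Lemma next_nth_mod (x0 : T) (c : seq T) p : uniq c -> (p < size c)%N ->
  next c (nth x0 c p) = nth x0 c (p.+1 %% size c).
Proof.
move=> Uc lp; rewrite next_nth mem_nth //.
case: c Uc lp => [//|y c] Uc lp; rewrite index_uniq //.
move: lp; rewrite /= ltnS leq_eqVlt => /predU1P[->|lp].
  by rewrite modnn nth_default.
by rewrite modn_small //= (set_nth_default y).
Qed.

(* [z] runs along the cycle forever and [zeta] accumulates its weight. *)
Lemma cycle_unroll e a (c : seq T) : elem_cycle e c ->
  exists (z : nat -> T) (zeta : nat -> R),
    [/\ forall p, z p \in c,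
        forall u v, (z u == z v) = (u == v %[mod size c]),
        forall u, zeta (u + size c)%N - zeta u = \sum_(i <- c) a i (next c i),
        forall u m, walk e a (z u) (z (u + m)%N) m (zeta (u + m)%N - zeta u) &
     forall p x, x \in c -> exists2 u, (p <= u)%N & z u = x /\ z u.+1 = next c x].
Proof.
case: c => [//|x0 c0]; set c := x0 :: c0 => /andP[_ /andP[cc Uc]].
set l := size c; have l0 : (0 < l)%N by [].
pose z p := nth x0 c (p %% l).
have zin p : z p \in c by rewrite mem_nth // ltn_mod.
have zS p : z p.+1 = next c (z p).
  by rewrite /z next_nth_mod ?ltn_mod // -[(p %% _).+1]addn1 modnDml addn1.
pose zeta u := \sum_(0 <= p < u) a (z p) (z p.+1).
have zl u : z (u + l)%N = z u by rewrite /z modnDr.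
have zetaS u : zeta u.+1 = zeta u + a (z u) (z u.+1) by rewrite /zeta big_nat_recr.
exists z, zeta; split; first exact: zin.
- by move=> u v; rewrite nth_uniq ?ltn_mod.
- elim=> [|u <-].
    rewrite [zeta 0%N]big_geq // subr0 /zeta (big_nth x0) -/l.
    by apply: eq_big_nat => p /andP[_ lp]; rewrite zS /z modn_small.
  rewrite addSn (zetaS (u + l)%N) (zetaS u) zl.
  by rewrite -[z (u + l).+1]/(z (u.+1 + l)%N) zl opprD addrACA subrr addr0.
- move=> u m; exists (fun p => z (p + u)%N); split.
  + by [].
  + by rewrite addnC.
  + by move=> p _; rewrite addSn zS; apply: next_cycle.
  rewrite /zeta (big_cat_nat (n := u)) ?leq_addr //= addrAC subrr add0r.
  by rewrite sum_shift.
- move=> p x xc; exists (index x c + p * l)%N; first by nia.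
  suff zx : z (index x c + p * l)%N = x by rewrite zS zx.
  by rewrite /z addnC modnMDl modn_small ?index_mem // nth_index.
Qed.

(** A node repeated inside a closed walk splits it into two shorter closed walks; without repetition
    the walk is an elementary cycle. *)
Lemma closed_walk_ind e a (P : nat -> R -> Prop) :
  P 0%N 0 ->
  (forall n m w v, P n w -> P m v -> P (n + m)%N (w + v)) ->
  (forall c, elem_cycle e c -> P (size c) (\sum_(i <- c) a i (next c i))) ->
  forall i n w, walk e a i i n w -> P n w.
Proof.
move=> P0 PD Pc i n; elim/ltn_ind: n i => n IH i w [f [f0 fn fe ->]].
case: (posnP n) => [->|n0]; first by rewrite big_geq.
have [/existsP[u /existsP[v /andP[luv /eqP fuv]]]|/existsPn inj] := boolP
  [exists u : 'I_n, exists v : 'I_n, (u < v)%N && (f u == f v)].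
  have lvn := ltn_ord v.
  have := subwalk a fe (ltnW luv) (ltnW lvn); rewrite -fuv => /IH P1.
  have := subwalk a fe (leq0n u) (ltnW (ltn_trans luv lvn)).
  have := subwalk a fe (ltnW lvn) (leqnn n).
  rewrite f0 fn -fuv => W2 /walk_cat /(_ W2) /IH P2.
  rewrite [X in P X](_ : n = ((v - u) + ((u - 0) + (n - v)))%N); last by lia.
  rewrite (@big_cat_nat _ _ _ u 0 n) ?(ltnW (ltn_ord u)) //=.
  rewrite (@big_cat_nat _ _ _ v u n) ?(ltnW luv) ?(ltnW lvn) //= addrCA.
  by apply: PD; [apply: P1|apply: P2]; lia.
have Uc : uniq (mkseq f n).
  apply/(uniqP i) => p r; rewrite !inE size_mkseq => lp lr.
  rewrite !nth_mkseq //; have := inj (Ordinal lp) => /existsPn /(_ (Ordinal lr)).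
  have := inj (Ordinal lr) => /existsPn /(_ (Ordinal lp)) /=.
  by case: (ltngtP p r) => //= _; rewrite ?andbT => /eqP + /eqP; congruence.
have nextE p : (p < n)%N -> next (mkseq f n) (f p) = f p.+1.
  move=> lp; rewrite -{1}(nth_mkseq i f lp) next_nth_mod ?size_mkseq //.
  rewrite nth_mkseq ?ltn_mod //; move: lp; rewrite leq_eqVlt => /predU1P[->|lp].
    by rewrite modnn f0 fn.
  by rewrite modn_small.
have -> : \sum_(0 <= p < n) a (f p) (f p.+1) =
          \sum_(i <- mkseq f n) a i (next (mkseq f n) i).
  rewrite big_map -/(index_iota 0 n) -{2}[n]subn0 -/(index_iota 0 n).
  by apply: eq_big_nat => p /andP[_ lp]; rewrite nextE.
rewrite -{1}(size_mkseq f n); apply: Pc; apply/andP; split.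
  by rewrite -size_eq0 size_mkseq -lt0n.
apply/andP; split => //; apply: cycle_from_next => // x /mapP[p].
by rewrite mem_iota add0n => /andP[_ lp] ->; rewrite nextE //; apply: fe.
Qed.
End Walks.

(** * Zero-sum-free sequences and Hamiltonian cycles *)

Section ZeroSumFree.
Variables (p : nat) (X : eqType) (s : X -> 'I_p.+2).
Implicit Types (l : seq X).

(** Subfamilies are taken up to permutation, so that deleted terms need not be consecutive. *)
Definition zero_sum_free l : Prop :=
  forall l1 l2, perm_eq l (l1 ++ l2) -> l1 != [::] -> \sum_(x <- l1) s x != 0.

(** Equal partial sums would leave a block of sum zero between the two cuts. *)
Lemma zero_sum_free_partial l i j : zero_sum_free l -> (i < j <= size l)%N ->
  \sum_(x <- take i l) s x != \sum_(x <- take j l) s x.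
Proof.
move=> zl /andP[lij lj]; apply/eqP => E.
set dr := drop i (take j l).
have Ej : take j l = take i l ++ dr by rewrite -{1}(cat_take_drop i (take j l)) take_takel // ltnW.
have := zl dr (take i l ++ drop j l); case/(_ _ _)/negP.
- by rewrite -{1}(cat_take_drop j l) Ej catA perm_cat2r perm_catC.
- by rewrite -size_eq0 size_drop size_takel //; lia.
by move: E; rewrite Ej big_cat /= -{1}[\sum_(x <- take i l) _]addr0 => /addrI <-.
Qed.

Lemma zero_sum_free_inj l : zero_sum_free l ->
  injective (fun i : 'I_(size l).+1 => \sum_(x <- take i l) s x).
Proof.
move=> zl i j E; apply/val_inj; case: (ltngtP i j) => // lij.
- by have := zero_sum_free_partial zl (i := i) (j := j); rewrite lij -ltnS ltn_ord E eqxx => /(_ isT).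
- by have := zero_sum_free_partial zl (i := j) (j := i); rewrite lij -ltnS ltn_ord E eqxx => /(_ isT).
Qed.

Lemma zero_sum_free_size l : zero_sum_free l -> (size l <= p.+1)%N.
Proof.
by move=> /zero_sum_free_inj /leq_card; rewrite !card_ord ltnS.
Qed.

Lemma zero_sum_free_perm l l' : perm_eq l l' -> zero_sum_free l -> zero_sum_free l'.
Proof. by move=> ll' zl l1 l2 /(perm_trans ll'); exact: zl. Qed.

(* The partial sums exhaust Z/q, hence contain [s y]; the only one of them that
   can equal [s y] without creating a zero-sum subsequence is [s x]. *)
Lemma zero_sum_free_max2 x y l : zero_sum_free (x :: y :: l) -> size l = p.-1 ->
  (0 < p)%N -> s y = s x.
Proof.
move=> zl sl p0; have inj := zero_sum_free_inj zl.
have eqc : (#|'I_(size [:: x, y & l]).+1| >= #|'I_p.+2|)%N.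
  by rewrite !card_ord /= sl; lia.
have /codomP[[j /= lj]] := inj_card_onto inj eqc (s y).
case: j lj => [|[|j]] /= lj.
- rewrite big_nil => sy0.
  have := zl [:: y] (x :: l); rewrite big_seq1 sy0 eqxx => /(_ _ isT)/negP; case=> //.
  by rewrite (perm_catCA [:: x] [:: y] l).
- by rewrite ?take0 big_seq1.
rewrite !big_cons => E.
have := zl (x :: take j l) (y :: drop j l); rewrite big_cons.
rewrite (_ : s x + _ = 0) ?eqxx; last first.
  by apply: (addrI (s y)); rewrite addr0 addrCA -E.
move=> /(_ _ isT)/negP; case => //=.
by rewrite perm_cons -{1}(cat_take_drop j l) (perm_catCA [:: y] (take j l) (drop j l)).
Qed.

(** Any member can be moved to second place, so the comparison of the first two members reaches all
    of them: families of the extremal size q - 1, where q = [p.+2], are constant. *)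
Lemma zero_sum_free_max x l : zero_sum_free (x :: l) -> size l = p ->
  {in x :: l, forall y, s y = s x}.
Proof.
move=> zl sl y; rewrite inE => /predU1P[->//|yl].
have p0 : (0 < p)%N by rewrite -sl; case: l yl {zl sl}.
apply: (zero_sum_free_max2 (l := rem y l)); rewrite ?size_rem ?sl //.
by apply: zero_sum_free_perm zl; rewrite perm_cons perm_to_rem.
Qed.

Lemma zero_sum_free_neq0 x l : zero_sum_free (x :: l) -> s x != 0.
Proof. by move=> zl; have := zl [:: x] l (perm_refl _) isT; rewrite big_seq1. Qed.

End ZeroSumFree.

Section Hamiltonian.
Variables (R : realType) (p : nat).
Local Notation q := (p.+2).
(** [V u v m w] is to be read as a walk of [m] steps from [u] to [v], the nodes being numbered along
    a Hamiltonian cycle and the weights corrected so that following this cycle costs nothing. Every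
    walk can be closed up along the cycle for free, which is why even open walks have [w <= 0]. *)
Variable V : 'I_q -> 'I_q -> nat -> R -> Prop.
Hypothesis V_cat : forall u v x m n w w',
  V u v m w -> V v x n w' -> V u x (m + n) (w + w').
Hypothesis V_rot : forall u m, V u (u + m%:R) m 0.
Hypothesis V_le0 : forall u v m w, V u v m w -> w <= 0.

(* An arc [(u, s, w)] leaves [u] and overshoots the successor of [u] on the
   Hamiltonian cycle by [s]. *)
Local Notation harc := ('I_q * 'I_q * R)%type.
Definition shortcut (x : harc) : Prop := V x.1.1 (x.1.1 + 1 + x.1.2) 1 x.2.

Lemma rot_to (a u : 'I_q) : exists m, [/\ (m < q)%N, u = a + m%:R & V a u m 0].
Proof.
have uE : u = a + (val (u - a))%:R by rewrite (natr_Zp (u - a : 'Z_q)) subrKC.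
exists (val (u - a)); split; [exact: ltn_ord|exact: uE|].
by have := V_rot a (val (u - a)); rewrite -uE.
Qed.

Lemma shortcut_reach x (a : 'I_q) : shortcut x ->
  exists m, [/\ (m <= q)%N, a + m%:R = x.1.1 + 1 & V a (x.1.1 + 1 + x.1.2) m x.2].
Proof.
move=> Vx; have [m [lm uE Vm]] := rot_to a x.1.1.
exists (m + 1)%N; split; first by rewrite addn1.
  by rewrite natrD addrA -uE.
by rewrite -[x.2]add0r; exact: V_cat Vm Vx.
Qed.

Lemma shortcuts_reach l (a : 'I_q) : (forall x, x \in l -> shortcut x) ->
  exists2 m, (m <= size l * q)%N &
    V a (a + m%:R + \sum_(x <- l) x.1.2) m (\sum_(x <- l) x.2).
Proof.
elim: l a => [|x l IH] a Hl.
  by exists 0%N => //; rewrite !big_nil addr0; exact: V_rot.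
have [m [lm mE Vm]] := shortcut_reach a (Hl _ (mem_head _ _)).
have [|m' lm' Vm'] := IH (x.1.1 + 1 + x.1.2).
  by move=> y yl; apply: Hl; rewrite inE yl orbT.
exists (m + m')%N; first by rewrite /= mulSn leq_add.
rewrite !big_cons; have := V_cat Vm Vm'.
by congr (V _ _ _ _); rewrite -mE natrD; ring.
Qed.

(** After a use of [x] the way back to its tail takes at most q - 2 steps, since q - 1 steps would
    mean excess zero. Each repetition thus costs at most q - 1 steps instead of q. *)
Lemma shortcut_repeat x (a : 'I_q) k : shortcut x -> x.1.2 != 0 ->
  exists m, [/\ (m <= p.+2 + k * p.+1)%N,
    a + m%:R + x.1.2 *+ k.+1 = x.1.1 + 1 + x.1.2 &
    V a (x.1.1 + 1 + x.1.2) m (x.2 *+ k.+1)].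
Proof.
move=> Vx s0; elim: k => [|k [m [lm mE Vm]]].
  have [m [lm mE Vm]] := shortcut_reach a Vx.
  by exists m; rewrite mul0n addn0 mulr1n mE.
have s1 : (0 < x.1.2)%N.
  by rewrite lt0n; apply: contra s0 => /eqP s0; apply/eqP/val_inj.
have [r [lr rE Vr]] := rot_to (x.1.1 + 1 + x.1.2) x.1.1.
have q0 : q%:R = 0 :> 'I_q by exact: (@pchar_Zp q).
have {}lr : (r < p.+1)%N.
  move: lr; rewrite ltnS leq_eqVlt => /predU1P[r1|//].
  case/eqP: s0; apply: (addrI x.1.1); rewrite addr0 [RHS]rE r1.
  by rewrite -[LHS]addr0 -q0 -natr1; ring.
exists (m + (r + 1))%N; split; first by rewrite mulSn; lia.
  rewrite mulrSr natrD natrD; set X := x.1.1 + 1 + _ in mE rE *.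
  rewrite (_ : _ + _ = (a + m%:R + x.1.2 *+ k.+1) + r%:R + 1 + x.1.2); last by ring.
  by rewrite mE -rE.
rewrite mulrSr; apply: V_cat Vm _; rewrite -[x.2]add0r.
exact: V_cat Vr Vx.
Qed.

Lemma seq_max_sum (X : eqType) (f : X -> R) x0 l :
  exists2 x, x \in x0 :: l & \sum_(z <- x0 :: l) f z <= f x *+ (size l).+1.
Proof.
elim: l x0 => [|y l IH] x0.
  by exists x0; rewrite ?inE // big_seq1.
have [x xl xmax] := IH y; case: (leP (f x) (f x0)) => lfx.
  exists x0; first exact: mem_head.
  rewrite big_cons mulrS lerD2l; apply: le_trans xmax _.
  by rewrite lerMn2r lfx orbT.
exists x; first by rewrite inE xl orbT.
by rewrite big_cons mulrS lerD // ltW.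
Qed.

(** Shortcuts may be reordered freely, as only their total excess fixes the end point. A smallest
    admissible family is zero-sum-free: deleting a zero-sum part keeps the end point and does not
    lower the weight. *)
Lemma hamiltonian_walk (y : nat -> 'I_q) (w : nat -> R) n' n :
  (forall k, (k < n')%N -> V (y k) (y k.+1) 1 (w k)) ->
  n%:R = n'%:R :> 'I_q -> (p.+1 ^ 2 + 1 <= n)%N ->
  exists2 w', \sum_(0 <= k < n') w k <= w' & V (y 0%N) (y n') n w'.
Proof.
move=> Vy nn' ln.
have tel m : y 0%N + m%:R + \sum_(0 <= k < m) (y k.+1 - y k - 1) = y m.
  elim: m => [|m IH]; first by rewrite big_geq // !addr0.
  by rewrite big_nat_recr //= -natr1 -[RHS](subrKC (y m)) -{1}IH; ring.
pose good l := [/\ forall x, x \in l -> shortcut x,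
  y 0%N + n%:R + \sum_(x <- l) x.1.2 = y n' &
  \sum_(0 <= k < n') w k <= \sum_(x <- l) x.2].
have good_ex : exists K, `[< exists2 l, good l & size l = K >].
  exists n'; apply/asboolP; exists [seq (y k, y k.+1 - y k - 1, w k) | k <- iota 0 n'];
    last by rewrite size_map size_iota.
  split.
  - move=> x /mapP[k]; rewrite mem_iota => /andP[_ lk] ->; rewrite /shortcut /=.
    by rewrite (_ : y k + 1 + _ = y k.+1); [exact: Vy|ring].
  - rewrite big_map /= -[X in iota 0 X]subn0 nn'; exact: tel.
  by rewrite big_map /= -[X in iota 0 X]subn0.
case: (ex_minnP good_ex) => K /asboolP[l [lV lE lW] <-] lmin.
have zl : zero_sum_free (fun x : harc => x.1.2) l.
  move=> l1 l2 ll12 l1N; apply/eqP => s0.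
  have /lmin : `[< exists2 l', good l' & size l' = size l2 >].
    apply/asboolP; exists l2 => //; split.
    - by move=> x xl; apply: lV; rewrite (perm_mem ll12) mem_cat xl orbT.
    - by rewrite -lE (perm_big _ ll12) big_cat /= s0 add0r.
    - apply: le_trans lW _; rewrite (perm_big _ ll12) big_cat /= gerDr.
      rewrite big_seq; apply: sumr_le0 => x xl; apply: V_le0.
      by apply: (lV x); rewrite (perm_mem ll12) mem_cat xl.
  by rewrite (perm_size ll12) size_cat -{2}[size l2]add0n leq_add2r leqn0 size_eq0 (negPf l1N).
have finish m w0 : (m <= n)%N -> \sum_(x <- l) x.2 <= w0 ->
    V (y 0%N) (y 0%N + m%:R + \sum_(x <- l) x.1.2) m w0 ->
    exists2 w', \sum_(0 <= k < n') w k <= w' & V (y 0%N) (y n') n w'.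
  move=> lmn lw0 Vm; exists w0; first exact: le_trans lw0.
  have := V_cat Vm (V_rot _ (n - m)); rewrite subnKC // addr0.
  by congr (V _ _ _ _); rewrite -lE natrB //; ring.
have := zero_sum_free_size zl; rewrite leq_eqVlt => /predU1P[szl|szl].
  case: l szl zl lV lE lW lmin finish => [//|x0 l] szl zl lV lE lW lmin finish.
  have seq_s := zero_sum_free_max zl (succn_inj szl).
  have [x xl xmax] := seq_max_sum (fun x : harc => x.2) x0 l.
  have sx0 : x.1.2 != 0 by rewrite seq_s //; exact: zero_sum_free_neq0 zl.
  (* All q - 1 excesses agree, so the heaviest shortcut can replace each of the others; this takes
     at most q + (q - 2)(q - 1) = (q - 1)^2 + 1 steps. *)
  have [m [lm mE]] := shortcut_repeat (y 0%N) p (lV _ xl) sx0.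
  have sE : \sum_(z <- x0 :: l) z.1.2 = x.1.2 *+ p.+1.
    rewrite big_seq (eq_bigr (fun=> x.1.2)) => [|z zin]; last by rewrite !seq_s.
    by rewrite -big_seq big_const_seq count_predT iter_addr_0 szl.
  rewrite -mE -sE => Vm; apply: finish Vm; first by nia.
  by move: xmax; rewrite -[(size l).+1]/(size (x0 :: l)) szl.
(* At most q - 2 shortcuts remain, taking at most q(q - 2) = (q - 1)^2 - 1 steps. *)
have [m lm Vm] := shortcuts_reach (y 0%N) lV.
by apply: finish Vm => //; apply: leq_trans lm _; nia.
Qed.
End Hamiltonian.

(** * Walks through a cycle of weight zero *)

Lemma card_le_mod m (D : {set 'I_m}) (g : nat -> nat) h : (0 < h)%N ->
  {in D &, forall b b' : 'I_m, (b < b')%N -> g b <> g b' %[mod h]} ->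
  (#|D| <= h)%N.
Proof.
move=> h0 inj; pose F (b : 'I_m) := Ordinal (ltn_pmod (g b) h0).
have Finj : {in D &, injective F}.
  move=> b b' bD b'D /(congr1 val) /= E; apply/val_inj.
  by case: (ltngtP b b') => // lb; [case: (inj b b')|case: (inj b' b)].
by rewrite -(card_in_imset Finj) -[leqRHS]card_ord max_card.
Qed.

Section Core.
Variables (R : realType) (T : finType) (e : rel T) (a : T -> T -> R) (gam : nat).
Hypothesis gam_gt0 : (0 < gam)%N.
Hypothesis closed_le0 : forall x n w, walk e a x x n w -> w <= 0.
Hypothesis closed_dvd : forall x n w, walk e a x x n w -> (gam %| n)%N.
Hypothesis conn : forall x y, exists n w, walk e a x y n w.

Definition cyc_class (i : T) (k : nat) : {set T} :=
  [set v | `[< exists n w, walk e a i v n w /\ n = k %[mod gam] >]].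

Lemma cyc_classP i n v w k : walk e a i v n w -> n = k %[mod gam] -> v \in cyc_class i k.
Proof. by move=> Hw nk; rewrite inE; apply/asboolP; exists n, w. Qed.

Lemma cyc_class_walk i k v : v \in cyc_class i k ->
  exists n w, walk e a i v n w /\ n = k %[mod gam].
Proof. by rewrite inE => /asboolP. Qed.

(** Both walks to [v] are closed by the same way back to [i], and [gam] divides both total
    lengths. *)
Lemma cyc_class_inj i k k' v : v \in cyc_class i k -> v \in cyc_class i k' ->
  k = k' %[mod gam].
Proof.
move=> /cyc_class_walk[n [w [Hw <-]]] /cyc_class_walk[n' [w' [Hw' <-]]].
have [m [u Hu]] := conn v i.
have /eqP := closed_dvd (walk_cat Hw Hu); have /eqP := closed_dvd (walk_cat Hw' Hu).
by move=> <- /eqP; rewrite eqn_modDr => /eqP.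
Qed.

Lemma sum_cyc_class i : (\sum_(k < gam) #|cyc_class i k| <= #|T|)%N.
Proof.
rewrite -sum1_card (eq_bigr (fun k : 'I_gam => \sum_(v : T) (v \in cyc_class i k) : nat)%N).
  rewrite exchange_big /=; apply: leq_sum => v _.
  have [/existsP[k vk]|/existsPn nv] := boolP [exists k : 'I_gam, v \in cyc_class i k].
    rewrite (bigD1 k) //= big1 ?addn0 ?leq_b1 // => k' k'k.
    apply/eqP; rewrite eqb0; apply: contra k'k => vk'.
    have := cyc_class_inj vk vk'; rewrite !modn_small // => E.
    exact/eqP/val_inj.
  by rewrite big1 // => k _; rewrite (negPf (nv k)).
by move=> k _; rewrite -sum1_card big_mkcond /=; apply: eq_bigr => v _; case: (_ \in _).
Qed.

(** Otherwise the [r + 1] classes with [k <= r] have at least [q + 1] nodes each and the others at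
    least [q], more than there are nodes. *)
Lemma small_cyc_class i q r : #|T| = (gam * q + r)%N -> (r < gam)%N ->
  exists2 k, (k < gam)%N & (#|cyc_class i k| + (r < k) <= q)%N.
Proof.
move=> dE rg; have [/existsP[k]|/existsPn big] := boolP
  [exists k : 'I_gam, (#|cyc_class i k| + (r < k) <= q)%N]; first by exists k.
have := sum_cyc_class i; rewrite dE leqNgt => /negP; case.
have -> : ((gam * q + r).+1 = \sum_(k < gam) (q + (k < r.+1)))%N.
  rewrite big_split /= sum_nat_const card_ord -addnS; congr addn.
  have -> : (\sum_(k < gam) (k < r.+1) = \sum_(k < gam | k < r.+1) 1)%N.
    by rewrite [RHS]big_mkcond /=; apply: eq_bigr => k _; case: (_ < _)%N.
  by rewrite -(big_ord_widen gam (fun=> 1%N)) // sum1_card card_ord.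
by apply: leq_sum => k _; have := big k; lia.
Qed.

(** [z] runs along a cycle of length [h * gam] and [zeta] accumulates its weight; periodicity of
    [zeta] says that the cycle has weight zero. *)
Variables (z : nat -> T) (zeta : nat -> R) (h : nat).
Hypothesis h_gt0 : (0 < h)%N.
Hypothesis z_eq : forall u v, (z u == z v) = (u == v %[mod h * gam]).
Hypothesis z_walk : forall u m, walk e a (z u) (z (u + m)%N) m (zeta (u + m)%N - zeta u).
Hypothesis zetaD : forall u, zeta (u + h * gam)%N = zeta u.

Definition on_cycle : {set T} := [set v | `[< exists u, v = z u >]].

Lemma on_cycleP u : z u \in on_cycle.
Proof. by rewrite inE; apply/asboolP; exists u. Qed.

Lemma card_cyc_class_on_cycle i u n w k : walk e a i (z u) n w ->
  (h <= #|cyc_class i k :&: on_cycle|)%N.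
Proof.
(* The term [n * gam.-1] cancels the length [n] of the approach modulo [gam]; from there the cycle
   meets class [k] once every [gam] steps. *)
move=> Hw; pose F (b : 'I_h) := z (u + (k + n * gam.-1 + gam * b))%N.
have Finj : injective F.
  move=> b b' /eqP; rewrite z_eq eqn_modDl eqn_modDl ![(gam * _)%N]mulnC -!muln_modl.
  by rewrite eqn_pmul2r // !modn_small // => /eqP /val_inj.
rewrite -[h in (h <= _)%N]card_ord -(card_imset _ Finj); apply/subset_leq_card/subsetP.
move=> _ /imsetP[b _ ->]; rewrite inE on_cycleP andbT.
apply: cyc_classP (walk_cat Hw (z_walk _ _)) _.
have -> : (n + (k + n * gam.-1 + gam * b) = (n + b) * gam + k)%N.
  by rewrite -[in RHS](prednK gam_gt0) mulnS; nia.
by rewrite modnMDl.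
Qed.

Lemma cycle_pad i j u n1 n2 w1 w2 t : walk e a i (z u) n1 w1 -> walk e a (z u) j n2 w2 ->
  (n1 + n2 <= t)%N -> (n1 + n2 = t %[mod h * gam]) -> walk e a i j t (w1 + w2).
Proof.
move=> W1 W2 le_t E.
have /dvdnP[r rE] : (h * gam %| t - (n1 + n2))%N by rewrite -eqn_mod_dvd // E.
have := z_walk u (h * gam); rewrite zetaD subrr.
have -> : z (u + h * gam)%N = z u by apply/eqP; rewrite z_eq modnDr.
move=> /walk_rep - /(_ r) /walk_cat /(_ W2) W3.
have := walk_cat W1 W3; rewrite mul0rn add0r addnCA -rE.
by rewrite subnK.
Qed.

(** * Walks without removable detours *)

Section Reduced.
Variables (f : nat -> T) (q0 n k m : nat).
Hypothesis lq0n : (q0 <= n)%N.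
Hypothesis reduced : forall u v u' v', (u <= v <= q0)%N -> (q0 <= u')%N -> (u' <= v' <= n)%N ->
  f u = f v -> f u' = f v' -> (h * gam %| (v - u) + (v' - u'))%N ->
  ((v - u) + (v' - u') = 0)%N.
Hypothesis first : forall p, (p < q0)%N -> f p \notin on_cycle.
Hypothesis lkm : (k + gam * m <= n)%N.

(* A closed detour before the first visit [q0] of the cycle and one after it can
   be cut together: the visits of [v] after [q0] are compared modulo [h] with
   those before [q0] once the gap around [q0] is closed up. *)
Lemma visits_le v :
  (#|[set b : 'I_m.+1 | f (k + gam * b)%N == v]| <= h + (v \notin on_cycle))%N.
Proof.
set S := [set b | _].
pose pos b := (k + gam * b)%N.
have posn (b : 'I_m.+1) : (pos b <= n)%N.
  by apply: leq_trans lkm; rewrite leq_add2l leq_mul2l -ltnS ltn_ord orbT.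
have posB b b' : (b <= b')%N -> (pos b' - pos b = gam * (b' - b))%N.
  by move=> lb; rewrite subnDl mulnBr.
have eq0P x y : (gam * x + gam * y = 0)%N -> (x + y = 0)%N by nia.
have dvdh x y : (h %| x + y)%N -> (h * gam %| gam * x + gam * y)%N.
  by move=> D; rewrite -mulnDr mulnC dvdn_pmul2l.
have lepos b b' : (b <= b')%N -> (pos b <= pos b')%N.
  by move=> lb; rewrite leq_add2l leq_mul2l lb orbT.
have fS b : b \in S -> f (pos b) = v by rewrite inE => /eqP.
have LL (b b' : 'I_m.+1) : b \in S -> b' \in S -> (b < b')%N -> (pos b' < q0)%N -> b <> b' %[mod h].
  move=> bS b'S lb lq /eqP; rewrite eq_sym eqn_mod_dvd ?(ltnW lb) // => D.
  have := @reduced (pos b) (pos b') q0 q0.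
  rewrite lepos ?(ltnW lb) // (ltnW lq) leqnn lq0n (fS b) // (fS b') //.
  rewrite subnn posB ?(ltnW lb) // -[X in (_ + X)%N](muln0 gam).
  move=> /(_ isT isT isT erefl erefl) H.
  have /eq0P := H (dvdh (b' - b) 0 (etrans (congr1 _ (addn0 _)) D))%N; lia.
have RR (b b' : 'I_m.+1) : b \in S -> b' \in S -> (b < b')%N -> (q0 <= pos b)%N -> b <> b' %[mod h].
  move=> bS b'S lb lq /eqP; rewrite eq_sym eqn_mod_dvd ?(ltnW lb) // => D.
  have := @reduced q0 q0 (pos b) (pos b').
  rewrite lepos ?(ltnW lb) // lq leqnn posn (fS b) // (fS b') //.
  rewrite subnn posB ?(ltnW lb) // -[X in (X + _)%N](muln0 gam).
  move=> /(_ isT isT isT erefl erefl) H.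
  have /eq0P := H (dvdh 0 (b' - b) D)%N; lia.
have LR (b b' c c' : 'I_m.+1) : b \in S -> b' \in S -> c \in S -> c' \in S ->
    (b <= b')%N -> (pos b' < q0)%N -> (q0 <= pos c)%N -> (c < c')%N ->
    ~ (h %| (b' - b) + (c' - c))%N.
  move=> bS b'S cS c'S lb lq lq' lc D.
  have := @reduced (pos b) (pos b') (pos c) (pos c').
  rewrite !lepos ?(ltnW lc) // lq' (ltnW lq) posn (fS b) // (fS b') // (fS c) // (fS c') //.
  rewrite !posB ?(ltnW lc) //.
  move=> /(_ isT isT isT erefl erefl) H.
  have /eq0P := H (dvdh _ _ D)%N; lia.
(* If [v] is not visited before [q0], its visits already have distinct residues modulo [h];
   otherwise [v] is off the cycle and one extra visit is allowed. *)
have [/set0Pn[bl0 bl0L]|/negPn/eqP L0] := boolP ([set b in S | pos b < q0]%N != set0); last first.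
  apply: leq_trans (leq_addr _ _); apply: (@card_le_mod _ _ id) => // b b' bS b'S lb; apply: RR => //.
  rewrite leqNgt; apply/negP => lq; have := in_set0 b.
  by rewrite -L0 inE bS lq.
have -> : v \notin on_cycle.
  by move: bl0L; rewrite inE => /andP[/fS <- /first].
rewrite addn1.
have [/set0Pn[br0 br0R]|/negPn/eqP R0] := boolP ([set b in S | q0 <= pos b]%N != set0); last first.
  apply: leqW; apply: (@card_le_mod _ _ id) => // b b' bS b'S lb; apply: LL => //.
  rewrite ltnNge; apply/negP => lq; have := in_set0 b'.
  by rewrite -R0 inE b'S lq.
rewrite !inE in bl0L br0R.
case: (@arg_maxnP _ bl0 (fun b => (b \in S) && (pos b < q0)%N) val) => [|bl /andP[blS blq] blmax].
  by rewrite !inE.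
case: (@arg_minnP _ br0 (fun b => (b \in S) && (q0 <= pos b)%N) val) => [|br /andP[brS brq] brmin].
  by rewrite !inE.
(* The first visit [br] from [q0] on is set aside as the extra one. Later visits are shifted by
   [bl - br], so that sharing a residue with an early visit yields a detour ending at [bl] and one
   starting at [br], removable together. *)
rewrite (cardsD1 br) brS add1n ltnS.
apply: (@card_le_mod _ _ (fun b => if pos b < q0 then b else b - br + bl)%N) => // b b'.
rewrite 2!inE => /andP[bbr bS]; rewrite 2!inE => /andP[b'br b'S] lb.
case: ltnP => lbq; case: ltnP => lb'q.
- exact: LL.
- have b'r : (br < b')%N by rewrite ltn_neqAle eq_sym (inj_eq val_inj) b'br /= brmin // b'S.
  have lbl : (b <= bl)%N by apply: blmax; rewrite bS.
  move=> /eqP; rewrite eq_sym eqn_mod_dvd; last by lia.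
  rewrite -addnBA // addnC; exact: LR.
- by have := lepos _ _ (ltnW lb); rewrite leqNgt (leq_trans lb'q lbq).
- have brb : (br < b)%N by rewrite ltn_neqAle eq_sym (inj_eq val_inj) bbr /= brmin // bS.
  move=> /eqP; rewrite eqn_modDr => /eqP E; apply: (RR b b') => //.
  by rewrite -(subnK (ltnW brb)) -(subnK (ltnW (ltn_trans brb lb))); apply/eqP; rewrite eqn_modDr; apply/eqP.
Qed.

(** The [m + 1] observed positions all fall in class [k]. Its nodes on the cycle, at least [h] of
    them, receive at most [h] visits each and the others at most [h + 1]. *)
Lemma class_visits_le i : (forall p, (p <= n)%N -> exists w, walk e a i (f p) p w) ->
  f q0 \in on_cycle -> (m.+1 + h <= h.+1 * #|cyc_class i k|)%N.
Proof.
move=> fw fq0.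
have fk (b : 'I_m.+1) : f (k + gam * b)%N \in cyc_class i k.
  have [|w Hw] := fw (k + gam * b)%N; last by apply: cyc_classP Hw _; rewrite addnC mulnC modnMDl.
  by apply: leq_trans lkm; rewrite leq_add2l leq_mul2l -ltnS ltn_ord orbT.
have hle : (h <= #|cyc_class i k :&: on_cycle|)%N.
  move: fq0; rewrite inE => /asboolP[u fE]; have [w] := fw _ lq0n.
  by rewrite fE => /card_cyc_class_on_cycle.
have cID := cardsID on_cycle (cyc_class i k).
suff : (m.+1 <= h * #|cyc_class i k| + #|cyc_class i k :\: on_cycle|)%N by rewrite mulSn; lia.
suff : (\sum_(b : 'I_m.+1) 1 <= h * #|cyc_class i k| + #|cyc_class i k :\: on_cycle|)%N.
  by rewrite sum1_card card_ord.
rewrite (partition_big (fun b : 'I_m.+1 => f (k + gam * b)%N) (mem (cyc_class i k))) //=.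
apply: (@leq_trans (\sum_(v in cyc_class i k) (h + (v \notin on_cycle)))).
  by apply: leq_sum => v _; rewrite sum1dep_card; exact: visits_le.
rewrite big_split /= sum_nat_const mulnC leq_add2l -sum1_card.
rewrite [leqRHS](eq_bigl (fun v => (v \in cyc_class i k) && (v \notin on_cycle))).
  by rewrite big_mkcondr /= leq_sum // => v _; case: (_ \in _).
by move=> v; rewrite inE andbC.
Qed.

End Reduced.

(* Among the walks of the right length modulo the length of the cycle, a
   shortest one visits no node too often. *)
Lemma walk_through_cycle i j u n1 n2 w1 w2 t q r :
  walk e a i (z u) n1 w1 -> walk e a (z u) j n2 w2 ->
  (n1 + n2 = t %[mod h * gam])%N ->
  #|T| = (gam * q + r)%N -> (r < gam)%N ->
  (h * gam * q + #|T| <= t + 2 * (h * gam))%N ->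
  exists2 w, w1 + w2 <= w & walk e a i j t w.
Proof.
move=> W1 W2 nt dE rg lt.
pose P n := `[< exists u n1 n2 w1' w2', [/\ walk e a i (z u) n1 w1', walk e a (z u) j n2 w2',
  n = (n1 + n2)%N, (n = t %[mod h * gam])%N & w1 + w2 <= w1' + w2'] >].
have exP : exists n, P n.
  by exists (n1 + n2)%N; apply/asboolP; exists u, n1, n2, w1, w2.
case: (ex_minnP exP) => n /asboolP[x [m1 [m2 [w1' [w2' [W1' W2' nE nt' lw]]]]]] nmin.
have [nlt|ltn_] := leqP n t.
  by exists (w1' + w2') => //; apply: cycle_pad W1' W2' _ _; rewrite -nE.
have [f [c [[f0 fm1] fn c0 cn sub]]] := walk_cat_split W1' W2'.
rewrite -nE in fn cn sub.
(* The junction is moved to the first visit of the cycle, so that no earlier node lies on it. *)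
have exq : exists p, f p \in on_cycle by exists m1; rewrite fm1 on_cycleP.
case: (ex_minnP exq) => q0 q0Z q0min.
have lq0 : (q0 <= n)%N.
  by apply: leq_trans (q0min m1 _) _; rewrite ?fm1 ?on_cycleP // nE leq_addr.
have reduced u1 v1 u2 v2 : (u1 <= v1 <= q0)%N -> (q0 <= u2)%N -> (u2 <= v2 <= n)%N ->
    f u1 = f v1 -> f u2 = f v2 -> (h * gam %| (v1 - u1) + (v2 - u2))%N ->
    ((v1 - u1) + (v2 - u2) = 0)%N.
  move=> /andP[luv1 lvq] lqu /andP[luv2 lvn] fuv1 fuv2 D.
  have C1 := sub u1 v1 luv1 (leq_trans lvq lq0).
  have C2 := sub u2 v2 luv2 lvn.
  rewrite -fuv1 in C1; rewrite -fuv2 in C2.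
  have S1 := sub 0%N u1 isT (leq_trans luv1 (leq_trans lvq lq0)); have S2 := sub v1 q0 lvq lq0.
  have S3 := sub q0 u2 lqu (leq_trans luv2 lvn); have S4 := sub v2 n lvn (leqnn n).
  rewrite -fuv1 in S2; rewrite -fuv2 in S4; rewrite f0 in S1; rewrite fn in S4.
  have X1 := walk_cat S1 S2; have X2 := walk_cat S3 S4.
  move: q0Z; rewrite inE => /asboolP[y yE]; rewrite yE in X1 X2.
  set D' := ((v1 - u1) + (v2 - u2))%N in D *.
  have nD : (n = (u1 - 0 + (q0 - v1) + (u2 - q0 + (n - v2))) + D')%N.
    by rewrite /D'; clear - luv1 lvq lqu luv2 lvn; lia.
  (* Cutting out both detours leaves a shorter walk through the cycle, with the same residue and no
     smaller weight because the detours are closed. *)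
  have /nmin : P (u1 - 0 + (q0 - v1) + (u2 - q0 + (n - v2)))%N.
    apply/asboolP; exists y; do 4 eexists; split; [exact: X1|exact: X2|reflexivity| |].
      by rewrite -nt' [in RHS]nD -(modnDmr _ D') (eqP D) addn0.
    have := closed_le0 C1; have := closed_le0 C2.
    by move: lw; rewrite c0 -cn; lra.
  by rewrite {1}nD; clear; lia.
have first p : (p < q0)%N -> f p \notin on_cycle.
  by move=> lp; apply/negP => /q0min; rewrite leqNgt lp.
have fw p : (p <= n)%N -> exists w, walk e a i (f p) p w.
  by move=> lp; have := sub 0%N p isT lp; rewrite f0 subn0 => Hw; eexists; exact: Hw.
have visits k m := fun H => @class_visits_le f q0 n k m lq0 reduced first H i fw q0Z.
have [k kg kq] := small_cyc_class i dE rg.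
(* A length above [t] in the same residue class exceeds it by at least one turn of the cycle. *)
have ltn2 : (t + h * gam <= n)%N.
  rewrite -(subnKC (ltnW ltn_)) leq_add2l; apply: dvdn_leq; first by rewrite subn_gt0.
  by rewrite -eqn_mod_dvd ?(ltnW ltn_) // nt'.
have lm : (gam * (h * q + q - h) + r <= n)%N.
  have gh : (gam <= h * gam)%N by rewrite leq_pmull.
  by rewrite !mulnBr !mulnDr; move: lt; rewrite dE; clear - gh rg ltn2; lia.
(* For [k > r] the class has at most [q - 1] nodes; for [k <= r] there is room for one more
   position. Either way the bound on visits is violated. *)
case: (ltnP r k) kq => [rk|kr] kq.
  have /visits : (k + gam * (h * q + q - h).-1 <= n)%N.
    have M0 : (0 < h * q + q - h)%N by clear - kq; nia.
    move: lm; case: (h * q + q - h)%N M0 => [//|M] _; rewrite /= mulnS.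
    by clear - kg; lia.
  by clear - kq; nia.
have /visits : (k + gam * (h * q + q - h) <= n)%N by clear - kr lm; lia.
by clear - kq h_gt0; nia.
Qed.

Lemma zeta_mod u v : u = v %[mod h * gam] -> zeta u = zeta v.
Proof.
have zM x y : zeta (x * (h * gam) + y)%N = zeta y.
  by elim: x => [|x IH]; rewrite ?mul0n // mulSn -addnA addnC zetaD.
by rewrite (divn_eq u (h * gam)) (divn_eq v (h * gam)) !modnMDl !modn_mod !zM => ->.
Qed.

(* When the cycle meets a smallest cyclicity class in all its nodes, the walk
   observed every [gam] steps lives on a Hamiltonian cycle. *)
Lemma walk_through_long_cycle p i j u n1 n2 w1 w2 t r :
  h = p.+2 -> walk e a i (z u) n1 w1 -> walk e a (z u) j n2 w2 ->
  (n1 + n2 = t %[mod h * gam])%N ->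
  #|T| = (gam * h + r)%N -> (r < gam)%N ->
  (gam * (p.+1 ^ 2 + 1) + r <= t)%N ->
  exists2 w, w1 + w2 <= w & walk e a i j t w.
Proof.
move=> hE W1 W2 nt dE rg lt.
have l0 : (0 < h * gam)%N by rewrite muln_gt0 h_gt0.
(* Turns of the cycle lengthen the walk to [t] plus a multiple of the cycle length, at the same
   weight. *)
have [M WL] : exists M, walk e a i j (t + M * (h * gam)) (w1 + w2).
  have lL : (t <= n1 + n2 + t * (h * gam))%N by rewrite -[t in (t <= _)%N]add0n leq_add // leq_pmulr.
  have /dvdnP[M ME] : (h * gam %| n1 + n2 + t * (h * gam) - t)%N.
    by rewrite -eqn_mod_dvd // addnC modnMDl nt.
  exists M; rewrite -ME subnKC //; apply: cycle_pad W1 W2 _ _; first exact: leq_addr.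
  by rewrite [in RHS]addnC modnMDl.
have [f [c [[f0 _] fn c0 cn sub]]] := walk_cat_split (walk0 e a i) WL.
rewrite !add0n add0r in fn cn sub.
have [k kg kq] := small_cyc_class i dE rg.
have hc := card_cyc_class_on_cycle k W1.
have hc' := subset_leq_card (subsetIl (cyc_class i k) on_cycle).
(* The cycle supplies [h] nodes of every class and the chosen class has at most [h], so it lies on
   the cycle and [k <= r]. *)
have [kr cE] : (k <= r)%N /\ #|cyc_class i k| = h.
  by move: kq hc hc'; clear; case: ltnP => ? /=; lia.
have classZ : cyc_class i k :&: on_cycle = cyc_class i k.
  by apply/eqP; rewrite eqEcard subsetIl cE.
have kt : (k <= t)%N by clear - kr lt; lia.
have fw q : (q <= t + M * (h * gam))%N -> walk e a i (f q) q (c q).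
  by move=> lq; have := sub 0%N q isT lq; rewrite f0 c0 subn0 subr0.
have Wk := fw k (leq_trans kt (leq_addr _ _)).
have : f k \in cyc_class i k by apply: cyc_classP Wk _.
rewrite -classZ inE => /andP[_]; rewrite inE => /asboolP[u0 fkE].
pose x_ (x : 'I_p.+2) := (u0 + gam * x)%N.
have z_inj : injective (fun x => z (x_ x)).
  move=> x y /eqP; rewrite z_eq eqn_modDl ![(gam * _)%N]mulnC -!muln_modl.
  by rewrite eqn_pmul2r // !modn_small ?hE // => /eqP /val_inj.
have classE v : v \in cyc_class i k -> exists x, v = z (x_ x).
  have -> : cyc_class i k = [set z (x_ x) | x in 'I_p.+2].
    apply/esym/eqP; rewrite eqEcard card_imset // card_ord cE hE leqnn andbT.
    apply/subsetP => _ /imsetP[x _ ->]; rewrite fkE in Wk.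
    by apply: cyc_classP (walk_cat Wk (z_walk u0 (gam * x))) _; rewrite addnC mulnC modnMDl.
  by move=> /imsetP[x _ ->]; exists x.
(* One step of [V] stands for [gam] arcs; subtracting differences of [zeta] gives steps along the
   cycle weight 0. *)
pose V x y m w := walk e a (z (x_ x)) (z (x_ y)) (gam * m) (w + (zeta (x_ y) - zeta (x_ x))).
have V_cat x y y' m m' w w' : V x y m w -> V y y' m' w' -> V x y' (m + m') (w + w').
  rewrite /V mulnDr => H1 H2; have := walk_cat H1 H2.
  by congr (walk _ _ _ _ _ _); ring.
have V_rot x m : V x (x + m%:R) m 0.
  have E : x_ x + gam * m = x_ (x + m%:R) %[mod h * gam].
    rewrite /x_ -addnA -mulnDr; apply/eqP; rewrite eqn_modDl mulnC [(gam * val _)%N]mulnC.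
    rewrite -!muln_modl eqn_pmul2r // hE.
    by rewrite /= (val_Zp_nat (isT : 1 < p.+2)%N m) /= modnDmr modn_mod.
  have zE : z (x_ (x + m%:R)) = z (x_ x + gam * m)%N by apply/eqP; rewrite z_eq E.
  by rewrite /V add0r -(zeta_mod E) zE.
have V_le0 x y m w : V x y m w -> w <= 0.
  move=> H; have := V_cat _ _ _ _ _ _ _ H (V_rot y (val (x - y))).
  rewrite (natr_Zp (x - y : 'Z_p.+2)) subrKC addr0 /V subrr addr0.
  exact: closed_le0.
(* [n] and [n'] count the blocks of [gam] arcs after position [k] in the target length and in the
   given walk; they agree modulo [h] and leave the same remainder. *)
pose n := ((t - k) %/ gam)%N; pose n' := (n + M * h)%N.
have tE : (t = k + gam * n + (t - k) %% gam)%N.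
  by rewrite -addnA [(gam * _)%N]mulnC -divn_eq subnKC.
have LE : (t + M * (h * gam) = k + gam * n' + (t - k) %% gam)%N.
  by rewrite {1}tE /n'; clear; lia.
have posL m : (m <= n')%N -> (k + gam * m <= t + M * (h * gam))%N.
  by move=> lm; rewrite LE -addnA leq_add2l (leq_trans _ (leq_addr _ _)) // leq_mul2l lm orbT.
have yex m : exists x, (m <= n')%N -> f (k + gam * m)%N = z (x_ x).
  have [lm|_] := leqP m n'; last by exists 0.
  have [|x xE] := classE (f (k + gam * m)%N); last by exists x.
  by apply: cyc_classP (fw _ (posL _ lm)) _; rewrite addnC mulnC modnMDl.
have [y yE] := choice yex.
pose w m := c (k + gam * m.+1)%N - c (k + gam * m)%N - (zeta (x_ (y m.+1)) - zeta (x_ (y m))).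
have Vy m : (m < n')%N -> V (y m) (y m.+1) 1 (w m).
  move=> lm; rewrite /V /w subrK -!yE ?(ltnW lm) // muln1.
  have gE : gam = (k + gam * m.+1 - (k + gam * m))%N by rewrite subnDl mulnS addnK.
  rewrite [X in walk _ _ _ _ X _]gE.
  by apply: sub (posL _ lm); rewrite leq_add2l leq_mul2l leqnSn orbT.
have nn' : n%:R = n'%:R :> 'I_p.+2.
  by rewrite /n' natrD natrM hE (_ : (p.+2)%:R = 0) ?mulr0 ?addr0 //; exact: (@pchar_Zp p.+2).
have ln : (p.+1 ^ 2 + 1 <= n)%N by rewrite /n leq_divRL //; clear - lt kr; lia.
have [w' lw' Vn] := hamiltonian_walk V_cat V_rot V_le0 Vy nn' ln.
have wE : \sum_(0 <= m < n') w m =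
    c (k + gam * n')%N - c k - (zeta (x_ (y n')) - zeta (x_ (y 0%N))).
  elim: (n') => [|m IH]; first by rewrite big_geq // muln0 addn0 !subrr.
  by rewrite big_nat_recr //= IH /w; ring.
rewrite /V -!yE // in Vn; rewrite muln0 addn0 in Vn.
have S3 := sub (k + gam * n')%N _ (posL _ (leqnn _)) (leqnn _).
rewrite fn cn LE addKn in S3.
have := walk_cat (walk_cat Wk Vn) S3; rewrite -tE => Wt.
by eexists; last exact: Wt; move: lw'; rewrite wE; lra.
Qed.

End Core.

(** * Max-plus matrix powers *)

Section Below.
Variable R : realType.
Implicit Types (x y b : rmax R) (w v u : R).

(** Elements of R_max are compared through the real numbers below them; -oo has none. *)
Definition below w x : bool := if x is Some v then w <= v else false.

Lemma below_le w v x : w <= v -> below v x -> below w x.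
Proof. by case: x => //= u; exact: le_trans. Qed.

Lemma below_inj x y : (forall w, below w x <-> below w y) -> x = y.
Proof.
case: x y => [x|] [y|] // H.
- congr Some; apply/eqP; rewrite eq_le.
  by apply/andP; split; [exact: (H x).1 (lexx x)|exact: (H y).2 (lexx y)].
- by have /= := (H x).1 (lexx _).
- by have /= := (H y).2 (lexx _).
Qed.

Lemma belowD w x y : below w (x + y) = below w x || below w y.
Proof. by case: x y => [x|] [y|] //=; rewrite ?le_max ?orbF. Qed.

Lemma below_sum (I : finType) (F : I -> rmax R) w :
  below w (\sum_i F i) <-> exists i, below w (F i).
Proof.
split=> [|[i Hi]]; last by rewrite (bigD1 i) //= belowD Hi.
elim/big_ind: _ => //= [x y Hx Hy|i _ Hi]; last by exists i.
by rewrite belowD => /orP[/Hx|/Hy].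
Qed.

Lemma belowM w x y :
  below w (x * y) <-> exists u v, [/\ below u x, below v y & w <= u + v].
Proof.
case: x y => [x|] [y|] /=; split => //; try by case=> [u [v []]].
  by move=> H; exists x, y; split => //=.
by move=> [u [v [/= ux vy /le_trans -> //]]]; apply: lerD.
Qed.

Lemma below_Fin w u : below w (Fin u) = (w <= u). Proof. by []. Qed.

Lemma below_scale w u x : below w (Fin u * x) = below (w - u) x.
Proof. by case: x => //= v; rewrite lerBlDl. Qed.

Lemma below_sup_ub (E : classical_sets.set (rmax R)) w v :
  (forall u, E (Fin u) -> u <= w) -> E (Fin v) -> below v (rmax_sup E).
Proof.
move=> Eub Ev; rewrite /rmax_sup; case: asboolP => [E0|]; last by case; exists v.
by apply: ub_le_sup => //; exists w => x; exact: Eub.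
Qed.

(** For finite [y] the value [b - y] bounds the set from above, hence also its supremum. *)
Lemma below_supM (E : classical_sets.set (rmax R)) w y b :
  (forall x v, E x -> below v (x * y) -> below v b) ->
  below w (rmax_sup E * y) -> below w b.
Proof.
rewrite /rmax_sup; case: asboolP => [[x0 /= Ex0]|//]; case: y => [y|//] H.
rewrite below_Fin => wle; have := H _ (x0 + y) Ex0 (lexx _).
case: b H => [b|//] H _ /=; apply: le_trans wle _.
rewrite -lerBrDr; apply: ge_sup; first by exists x0.
by move=> x Ex; have := H _ (x + y) Ex (lexx _); rewrite lerBrDr.
Qed.

End Below.

Section Powers.
Variables (R : realType) (d : nat).
Implicit Types A : 'M[rmax R]_d.

Definition wgt A i j : R := rval (A i j).
Definition mxwalk A := walk (arc A) (wgt A).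

(** Induction on [n], peeling off the first arc; matrix identities thereby become statements on
    walks. *)
Lemma below_pow A n i j w :
  below w ((A ^+ n) i j) <-> exists2 v, w <= v & mxwalk A i j n v.
Proof.
elim: n i w => [|n IH] i w.
  rewrite expr0 mxE; case: eqVneq => [->|nij].
    split=> [w0|[v wv [f [_ _ _ vE]]]]; last by rewrite vE big_geq in wv.
    by exists 0 => //; exact: walk0.
  split=> //= -[v _ [f [f0 fn _ _]]]; case/eqP: nij; congruence.
rewrite exprS mxE; split.
  move=> /below_sum[k /belowM[u [v [uA vA wuv]]]].
  have [v' vv' Hv'] := (IH _ _).1 vA.
  exists (wgt A i k + v'); last first.
    rewrite -add1n; apply: walk_cat Hv'; apply: walk1.
    by move: uA; rewrite /arc; case: (A i k).
  apply: le_trans wuv _; apply: lerD => //.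
  by move: uA; rewrite /wgt; case: (A i k).
move=> [v wv /walkSl[k [v' [aik Hv' vE]]]].
apply/below_sum; exists k; apply/belowM; exists (wgt A i k), v'; split.
- by move: aik; rewrite /arc /wgt; case: (A i k) => //= x _; exact: lexx.
- by apply/IH; exists v'.
- by rewrite -vE.
Qed.

Lemma scale_pow A u n : (Fin u *: A) ^+ n = Fin u ^+ n *: A ^+ n.
Proof. 
elim: n => [|n IH]; first by rewrite !expr0 scale1r.
by rewrite !exprS IH -!mulmxE -scalemxAl -scalemxAr scalerA.
Qed.

End Powers.

(** * Critical graph *)

Section CycleLengths.
Variables (T : finType) (e : rel T).
Implicit Types (K : {set T}) (c : seq T).

Lemma elem_cycle_size c : elem_cycle e c -> (0 < size c <= #|T|)%N.
Proof.
case/andP=> c0 /andP[_ /card_uniqP sc]; rewrite -{2}sc max_card andbT.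
by case: c c0 {sc}.
Qed.

Lemma has_cycle_lenP K n :
  reflect (exists c, [/\ elem_cycle e c, {subset c <= K} & size c = n]) (has_cycle_len e K n).
Proof.
apply: (iffP existsP) => [[c /andP[ec /allP cK]]|[c [ec cK <-]]].
  by exists c; rewrite size_tuple.
by exists (in_tuple c); rewrite ec; apply/allP.
Qed.

Lemma has_cycle_len_bound K n : has_cycle_len e K n -> (0 < n <= #|T|)%N.
Proof. by case/has_cycle_lenP=> c [/elem_cycle_size + _ <-]. Qed.

Lemma scc_cyclicity_dvd K n : has_cycle_len e K n -> (scc_cyclicity e K %| n)%N.
Proof.
move=> Kn; have /andP[_ ln] := has_cycle_len_bound Kn.
by apply: (biggcdn_inf (Ordinal (ln : (n < #|T|.+1)%N))).
Qed.

Lemma girth_attained K n : has_cycle_len e K n -> has_cycle_len e K (girth e K).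
Proof.
move=> Kn; have /andP[_ ln] := has_cycle_len_bound Kn.
have [gK|] : girth e K = #|T| \/ has_cycle_len e K (girth e K); last by [].
  rewrite /girth; apply: (big_ind (fun g => g = #|T| \/ has_cycle_len e K g)).
  - by left.
  - by move=> x y Hx Hy; rewrite /minn; case: ifP.
  - by move=> i Hi; right.
(* The minimum starts from the default [#|T|]; if it returned that value, [n] would equal [#|T|] and
   attain it. *)
suff : (girth e K <= n)%N by rewrite gK => ?; have -> : #|T| = n by lia.
rewrite /girth; set i0 := Ordinal (ln : (n < #|T|.+1)%N).
elim: (index_enum _) (mem_index_enum i0) => // i r IH; rewrite inE big_cons.
case/predU1P=> [<-|/IH ir]; first by rewrite Kn geq_minl.
by case: ifP => // _; rewrite geq_min ir orbT.
Qed.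

Lemma scc_cyclicity_girth K : (0 < scc_cyclicity e K)%N -> has_cycle_len e K (girth e K).
Proof.
move=> K0; have [/existsP[n Kn]|/existsPn noK] := boolP
  [exists n : 'I_#|T|.+1, has_cycle_len e K n]; first exact: girth_attained Kn.
by move: K0; rewrite /scc_cyclicity big1 // => i Hi; have := noK i; rewrite Hi.
Qed.

Variables (R : realType) (a : T -> T -> R).

(** The residues modulo [m] of lengths of closed walks at [k] form a subgroup, which therefore
    contains the gcd of the cycle lengths of the component. *)
Lemma closed_walk_mod k m s : (0 < m)%N -> (scc_cyclicity e (scc e k) %| s)%N ->
  exists N w, walk e a k k N w /\ N = s %[mod m].
Proof.
move=> m0; pose H n := exists N w, walk e a k k N w /\ N = n %[mod m].
have HD x y : H x -> H y -> H (x + y)%N.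
  move=> [N [w [HN Nx]]] [N' [w' [HN' Ny]]]; exists (N + N')%N, (w + w'); split.
    exact: walk_cat HN HN'.
  by rewrite -modnDm Nx Ny modnDm.
have H0 : H 0%N by exists 0%N, 0; split => //; exact: walk0.
have HM r x : H x -> H (r * x)%N.
  by move=> Hx; elim: r => [|r IH]; rewrite ?mul0n // mulSn; exact: HD.
have Hmod x y : x = y %[mod m] -> H x -> H y by move=> E [N [w [HN Nx]]]; exists N, w; rewrite -E.
have Hgcd x y : H x -> H y -> H (gcdn x y).
  case: x => [|x] Hx Hy; first by rewrite gcd0n.
  case: (egcdnP y (ltn0Sn x)) => km kn E _.
  (* In the Bezout identity, the negative term is replaced by [m.-1] times its absolute value. *)
  apply: (Hmod (km * x.+1 + m.-1 * (kn * y))%N); last exact: HD (HM _ _ Hx) (HM _ _ (HM _ _ Hy)).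
  rewrite E -[in RHS](modnMDl (kn * y)); congr (_ %% _)%N.
  by rewrite -{2}(prednK m0); lia.
suff Hs : H (scc_cyclicity e (scc e k)) by move=> /dvdnP[c ->]; exact: HM.
rewrite /scc_cyclicity; apply: (big_ind H) => // n /has_cycle_lenP[c [ec cK <-]].
have [z [zeta [zin z_eq zetaD z_walk _]]] := cycle_unroll a ec.
have := cK _ (zin 0%N); rewrite inE => /andP[/(connect_walk a)[n1 [w1 W1]] /(connect_walk a)[n2 [w2 W2]]].
have := z_walk 0%N (size c); rewrite add0n.
have -> : z (size c) = z 0%N by apply/eqP; rewrite z_eq modnn mod0n.
move=> Wc; do 2 eexists; split.
  (* The round trip to the cycle is made [m] times in all, with the cycle inserted once, so only
     [size c] remains modulo [m]. *)
  exact: walk_cat (walk_cat W1 (walk_cat Wc W2)) (walk_rep m.-1 (walk_cat W1 W2)).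
rewrite (_ : _ + _ = (n1 + n2) * m + size c)%N ?modnMDl //.
by rewrite -{2}(prednK m0); lia.
Qed.

End CycleLengths.

Section Critical.
Variables (R : realType) (T : finType) (e : rel T) (a : T -> T -> R).
Hypothesis closed_le0 : forall x n w, walk e a x x n w -> w <= 0.
Variable crit : rel T.
Hypothesis critP : forall x y, crit x y <->
  exists c, [/\ elem_cycle e c, \sum_(i <- c) a i (next c i) = 0, x \in c & y = next c x].

Lemma crit_sub x y : crit x y -> e x y.
Proof.
by move=> /critP[c [/andP[_ /andP[cc _]] _ xc ->]]; exact: next_cycle.
Qed.

Lemma crit_cycle c : elem_cycle e c -> \sum_(i <- c) a i (next c i) = 0 -> elem_cycle crit c.
Proof.
move=> ec c0; have /andP[cN /andP[cc Uc]] := ec; rewrite /elem_cycle cN /ucycleb Uc andbT.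
by apply: cycle_from_next => // x xc; apply/critP; exists c.
Qed.

Lemma crit_walk x y n w : walk crit a x y n w -> walk e a x y n w.
Proof. by apply: walk_mono => u v /crit_sub. Qed.

Lemma crit_back x y : crit x y -> exists n, walk crit a y x n (- a x y).
Proof.
move=> cxy; have /critP[c [ec c0 xc yE]] := cxy.
have [z [zeta [_ z_eq zetaD z_walk zx]]] := cycle_unroll a (crit_cycle ec c0).
have /andP[l0 _] := elem_cycle_size ec.
have [u _ [zu zu1]] := zx 0%N x xc; exists (size c).-1.
have := z_walk u.+1 (size c).-1.
rewrite addSnnS prednK // (_ : z (u + size c)%N = x); last first.
  by rewrite -zu; apply/eqP; rewrite z_eq modnDr.
rewrite zu1 -yE; congr (walk _ _ _ _ _ _).
have := z_walk u 1%N; rewrite addn1 zu zu1 -yE => /walkSl[k [v [_ [f [f0 f1 _ vE]] wE]]].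
rewrite big_geq // in vE; move: (zetaD u); rewrite c0 => /eqP; rewrite subr_eq0 => /eqP ->.
by move: wE; rewrite vE -f0 f1 addr0 => <-; rewrite opprB.
Qed.

(* Each critical arc is reversed by the rest of its critical cycle. *)
Lemma crit_rev x y n w : walk crit a x y n w -> exists m, walk crit a y x m (- w).
Proof.
elim: n x w => [|n IH] x w.
  by move=> [f [f0 fn _ ->]]; exists 0%N; rewrite big_geq // oppr0 -fn f0; exact: walk0.
move=> /walkSl[k [v [/crit_back[m Wm] /IH[m' Wm'] ->]]].
by exists (m' + m)%N; rewrite opprD addrC; exact: walk_cat Wm' Wm.
Qed.

(** The reversed walk is closed too and has the opposite weight, while both weights are at most
    0. *)
Lemma crit_closed x n w : walk crit a x x n w -> w = 0.
Proof.
move=> Hw; have [m Hm] := crit_rev Hw.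
have := closed_le0 (crit_walk Hw); have := closed_le0 (crit_walk Hm); lra.
Qed.

End Critical.

(** * CSR terms *)

Section Normalized.
Variables (R : realType) (d : nat) (A : 'M[rmax R]_d).
Hypothesis irrA : Defs.irreducible A.
Hypothesis d_gt0 : (0 < d)%N.

Local Notation lam := (max_cycle_mean A).
Local Notation N := (normalized A).
Local Notation gam := (graph_cyclicity A).
Local Notation sig := (crit_cyclicity A).
Local Notation crit := (crit_arc A).

Lemma arc_normalized : arc N = arc A.
Proof. by apply/funext => i; apply/funext => j; rewrite /arc mxE; case: (A i j). Qed.

Lemma wgt_normalized i j : arc A i j -> wgt N i j = wgt A i j - lam.
Proof. by rewrite /arc /wgt mxE; case: (A i j) => //= v _; rewrite addrC. Qed.

Lemma cycle_mean_le c : elem_cycle (arc A) c -> cycle_mean A c <= lam.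
Proof.
move=> ec; apply: ub_le_sup; last by exists c.
exists (\sum_i \sum_j `|wgt A i j|) => _ [c' ec' ->].
have /andP[s0 _] := elem_cycle_size ec'.
rewrite /cycle_mean ler_pdivrMr ?ltr0n // mulr_natr -iter_addr_0 -(count_predT c').
rewrite -big_const_seq; apply: ler_sum => i _; apply: le_trans (ler_norm _) _.
rewrite (bigD1 i) //= (bigD1 (next c' i)) //= -addrA lerDl.
by rewrite addr_ge0 // ?sumr_ge0 // => x _; rewrite ?sumr_ge0.
Qed.

Lemma cycle_wgt_normalized c : elem_cycle (arc A) c ->
  \sum_(i <- c) wgt N i (next c i) = (cycle_mean A c - lam) * (size c)%:R.
Proof.
move=> ec; have /andP[s0 _] := elem_cycle_size ec.
have /andP[_ /andP[cc _]] := ec.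
rewrite big_seq (eq_bigr (fun i => wgt A i (next c i) - lam)); last first.
  by move=> i ic; apply: wgt_normalized; exact: next_cycle.
rewrite -big_seq big_split /= mulrBl divfK ?pnatr_eq0 -?lt0n //; congr (_ + _).
by rewrite big_const_seq count_predT iter_addr_0 -mulNr mulr_natr.
Qed.

Lemma normalized_closed_walk_le0 x n w : mxwalk N x x n w -> w <= 0.
Proof.
apply: (closed_walk_ind (P := fun _ w => w <= 0)) => //.
  by move=> _ _ u v; lra.
move=> c; rewrite arc_normalized => ec; rewrite cycle_wgt_normalized //.
by rewrite mulr_le0_ge0 // subr_le0 cycle_mean_le.
Qed.

Lemma crit_arcP x y : crit x y <-> exists c, [/\ elem_cycle (arc N) c,
  \sum_(i <- c) wgt N i (next c i) = 0, x \in c & y = next c x].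
Proof.
have H c : elem_cycle (arc A) c -> (\sum_(i <- c) wgt N i (next c i) = 0 <-> cycle_mean A c = lam).
  move=> ec; rewrite cycle_wgt_normalized //; have /andP[s0 _] := elem_cycle_size ec.
  split=> [/eqP|->]; last by rewrite subrr mul0r.
  by rewrite mulf_eq0 pnatr_eq0 -(negbK (_ == 0%N)) -lt0n s0 orbF subr_eq0 => /eqP.
rewrite arc_normalized; split=> [/asboolP[c [ec cm] [xc yE]]|[c [ec cm xc yE]]].
  by exists c; split => //; apply/H.
by apply/asboolP; exists c => //; split => //; apply/H.
Qed.

Lemma crit_nodesP k : k \in crit_nodes A <-> exists c, [/\ elem_cycle (arc N) c,
  \sum_(i <- c) wgt N i (next c i) = 0 & k \in c].
Proof.
split.
  rewrite inE => /asboolP[c cc kc].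
  have : crit k (next c k) by apply/asboolP; exists c.
  by move=> /crit_arcP[c' [ec' c0 kc' _]]; exists c'.
move=> [c [ec c0 kc]].
have : crit k (next c k) by apply/crit_arcP; exists c.
by move=> /asboolP[c' cc' [kc' _]]; rewrite inE; apply/asboolP; exists c'.
Qed.

Lemma crit_nodes_walk k x n w : k \in crit_nodes A -> walk crit (wgt N) k x n w ->
  x \in crit_nodes A.
Proof.
move=> kc; case: n => [|n] [f [f0 fn fe _]]; first by rewrite -fn f0.
have /crit_arcP[c [ec c0 xc yE]] := fe n (ltnSn n).
by apply/crit_nodesP; exists c; split; rewrite // -fn yE mem_next.
Qed.

Lemma irreducible_walk x y : exists n w, mxwalk N x y n w.
Proof.
case: irrA => sc _; apply: connect_walk; rewrite arc_normalized; exact: sc.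
Qed.

Lemma graph_cyclicity_dvd x n w : mxwalk N x x n w -> (gam %| n)%N.
Proof.
apply: (closed_walk_ind (P := fun n _ => (gam %| n)%N)) => //.
  by move=> ? ? _ _; exact: dvdn_add.
move=> c; rewrite arc_normalized => ec; apply: scc_cyclicity_dvd.
by apply/has_cycle_lenP; exists c; split => // y; rewrite inE.
Qed.

Lemma exists_arc : exists i j, arc A i j.
Proof.
case: irrA => sc nd.
have [/existsP[i /existsP[j aij]]|/existsPn na] := boolP [exists i, exists j, arc A i j].
  by exists i, j.
have noarc i j : arc A i j = false.
  by have := na i; rewrite negb_exists => /forallP /(_ j) /negbTE.
case: nd; split; last by move=> i j; apply/eqP/negPn; rewrite -/(arc A i j) noarc.
apply/eqP; rewrite eqn_leq d_gt0 andbT leqNgt; apply/negP => d1.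
have /connectP[[|y s] /=] := sc (Ordinal d_gt0) (Ordinal d1); last by rewrite noarc.
by move=> _ /(congr1 val).
Qed.

(** An arc and a way back form a closed walk of positive length, so [gam] is not 0; it divides the
    girth, which is at most [d]. *)
Lemma graph_cyclicity_bounds : (0 < gam <= d)%N.
Proof.
have [i [j aij]] := exists_arc; rewrite -arc_normalized in aij.
have [n [w Hw]] := irreducible_walk j i.
have D := graph_cyclicity_dvd (walk_cat (walk1 (wgt N) aij) Hw).
have g0 : (0 < gam)%N by rewrite lt0n; apply: contraTneq D => ->; rewrite dvd0n add1n.
rewrite g0; have Kg := scc_cyclicity_girth g0.
have /andP[l0 ld] := has_cycle_len_bound Kg.
by rewrite card_ord in ld; apply: leq_trans ld; apply: dvdn_leq => //; exact: scc_cyclicity_dvd.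
Qed.

Lemma crit_component_cycle k : k \in crit_nodes A -> 
  exists n, has_cycle_len crit (scc crit k) n.
Proof.
move=> /crit_nodesP[c [ec c0 kc]]; exists (size c).
have cc := crit_cycle crit_arcP ec c0.
apply/has_cycle_lenP; exists c; split=> // x xc.
have /andP[_ /andP[cyc _]] := cc.
rewrite inE; have := connect_cycle cyc kc xc; have := connect_cycle cyc xc kc.
by move=> -> ->.
Qed.

Lemma crit_cyclicity_gt0 : (0 < sig)%N.
Proof.
rewrite /crit_cyclicity; apply: (big_ind (fun x => 0 < x)%N) => //.
  by move=> x y x0 y0; rewrite lcmn_gt0 x0.
move=> K /imsetP[k kc ->]; have [n Kn] := crit_component_cycle kc.
have /andP[n0 _] := has_cycle_len_bound Kn.
exact: dvdn_gt0 n0 (scc_cyclicity_dvd Kn).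
Qed.

Lemma scc_cyclicity_dvd_crit k : k \in crit_nodes A ->
  (scc_cyclicity crit (scc crit k) %| sig)%N.
Proof. by move=> kc; apply: (biglcmn_sup (scc crit k)) => //; exact: imset_f. Qed.

Lemma csrM_walk i k n w : mxwalk N i k n w -> (sig %| n)%N -> below w (csrM A i k).
Proof.
move=> Hw /dvdnP[q nE]; rewrite mulnC in nE.
have : below w (((N ^+ sig) ^+ q) i k) by rewrite -exprM -nE; apply/below_pow; exists w.
case E : (((N ^+ sig) ^+ q) i k) => [v|] // wv; apply: below_le wv _.
rewrite /csrM mxE; have [m [u Hu]] := irreducible_walk k i.
(* A return walk of weight [u] forces every walk from [i] to [k] to weigh at most [- u], so the
   supremum is over a bounded set. *)
apply: (below_sup_ub (w := - u)); last by exists q.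
move=> x [q' xE]; have : below x ((N ^+ (sig * q')) i k) by rewrite exprM -xE below_Fin.
by move=> /below_pow[v' xv' /walk_cat /(_ Hu) /normalized_closed_walk_le0]; lra.
Qed.

Lemma csrM_below i k w y b : 
  (forall n v u, mxwalk N i k n v -> (sig %| n)%N -> below u y -> below (v + u) b) ->
  below w (csrM A i k * y) -> below w b.
Proof.
move=> H; rewrite /csrM mxE; apply: below_supM => x v [q ->] /belowM[u [u' [ux u'y /below_le]]].
apply; move: ux; rewrite -exprM => /below_pow[v' uv' Hv'].
by apply: (below_le (v := v' + u')); [rewrite lerD2r|apply: H Hv' _ u'y; exact: dvdn_mulr].
Qed.

Lemma below_csrS k l t w :
  below w ((csrS A ^+ t) k l) <-> exists2 v, w <= v & walk crit (wgt N) k l t v.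
Proof.
have H x y : (arc (csrS A) x y = crit x y) /\ (crit x y -> wgt (csrS A) x y = wgt N x y).
  rewrite /wgt /arc mxE; case: ifP => // cxy; split => //.
  by have := crit_sub crit_arcP cxy.
rewrite below_pow; split=> -[v wv Hv]; exists v => //; move: Hv; apply: walk_mono => x y.
  by have [-> E] := H x y => cxy; rewrite E.
by have [-> E] := H x y => cxy; rewrite E.
Qed.

Lemma csrE t i j : csr A t i j = \sum_l (\sum_k csrC A i k * (csrS A ^+ t) k l) * csrR A l j.
Proof. by rewrite /csr mxE; apply: eq_bigr => l _; rewrite mxE. Qed.

Lemma csrCE i k : csrC A i k = if k \in crit_nodes A then csrM A i k else NInf.
Proof. by rewrite mxE. Qed.

Lemma csrRE k j : csrR A k j = if k \in crit_nodes A then csrM A k j else NInf.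
Proof. by rewrite mxE. Qed.

(* A long closed critical walk at [k] is inserted and cut so that the two outer
   pieces have lengths divisible by the cyclicity. *)
Lemma csr_walk i j k n1 n2 w1 w2 : k \in crit_nodes A ->
  mxwalk N i k n1 w1 -> mxwalk N k j n2 w2 -> below (w1 + w2) (csr A (n1 + n2) i j).
Proof.
move=> kc W1 W2; set t := (n1 + n2)%N.
have /crit_nodesP[c [ec c0 kinc]] := kc.
have [z [zeta [_ z_eq zetaD z_walk zx]]] := cycle_unroll (wgt N) (crit_cycle crit_arcP ec c0).
have /andP[l0 _] := elem_cycle_size ec.
have [u _ [zu _]] := zx 0%N k kinc.
have := z_walk u (size c); have -> : z (u + size c)%N = z u by apply/eqP; rewrite z_eq modnDr.
rewrite zetaD c0 zu => /(walk_rep (sig * t)) Wc; rewrite mul0rn in Wc.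
have [f [v [[f0 _] fn v0 vn sub]]] := walk_cat_split (walk0 _ _ k) Wc.
rewrite add0n addr0 in fn vn sub; set L := (sig * t * size c)%N in fn vn sub.
have s0 := crit_cyclicity_gt0.
(* With this cut, the first outer piece has length [n1 + al = sig * n1] and the last has length
   [L - sig * n1], where [sig] divides [L]. *)
pose al := (sig.-1 * n1)%N.
have lL : (al + t <= L)%N.
  apply: (@leq_trans (sig * t)); last by rewrite leq_pmulr.
  by rewrite -[in leqRHS](prednK s0) mulSn addnC leq_add2l leq_mul2l leq_addr orbT.
have al_L : (al <= L)%N by apply: leq_trans lL; exact: leq_addr.
have S1 := sub 0%N al isT al_L; have S2 := sub al (al + t)%N (leq_addr _ _) lL.
have S3 := sub (al + t)%N L lL (leqnn _).
rewrite f0 in S1; rewrite fn in S3.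
have kal := crit_nodes_walk kc S1; have kalt := crit_nodes_walk kal S2.
rewrite csrE; apply/below_sum; exists (f (al + t)%N); rewrite csrRE kalt.
apply/belowM; exists (w1 + v (al + t)%N), (w2 - v (al + t)%N); split; last by lra.
- apply/below_sum; exists (f al); rewrite csrCE kal.
  apply/belowM; exists (w1 + v al), (v (al + t)%N - v al); split; last by lra.
    have := walk_cat W1 (crit_walk crit_arcP S1); rewrite subn0 v0 subr0 => /csrM_walk.
    by apply; rewrite -mulSn prednK // dvdn_mulr.
  by rewrite addKn in S2; apply/below_csrS; exists (v (al + t)%N - v al).
have := walk_cat (crit_walk crit_arcP S3) W2.
rewrite vn sub0r addrC => /csrM_walk; apply.
have -> : (L - (al + t) + n2 = sig * (t * size c) - sig * n1)%N.
  have E : (sig * n1 = n1 + al)%N by rewrite -mulSn prednK.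
  by rewrite E mulnA -/L; move: lL; rewrite /t; clear; lia.
by rewrite -mulnBr dvdn_mulr.
Qed.

Lemma csr_below i j t w b :
  (forall k l n1 n2 w1 w2 s, k \in crit_nodes A -> mxwalk N i k n1 w1 ->
    walk crit (wgt N) k l t s -> mxwalk N l j n2 w2 -> (sig %| n1)%N -> (sig %| n2)%N ->
    below (w1 + s + w2) b) ->
  below w (csr A t i j) -> below w b.
Proof.
move=> H; rewrite csrE => /below_sum[l].
move=> /belowM[u [u' [/below_sum[k uC] u'R /below_le]]]; apply; move: u'R uC.
rewrite csrRE csrCE; case: ifP => // lc u'R; case: ifP => // kc uC.
have : below (u + u') (csrM A i k * ((csrS A ^+ t) k l * csrM A l j)).
  rewrite mulrA; apply/belowM; by exists u, u'.
apply: csrM_below => n1 w1 x W1 D1; rewrite mulrC => Hx.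
have : below (w1 + x) (csrM A l j * (Fin w1 * (csrS A ^+ t) k l)).
  by rewrite mulrCA below_scale addrAC subrr add0r.
apply: csrM_below => n2 w2 y W2 D2; rewrite below_scale => /below_csrS[s ys Ws].
apply: (below_le (v := w1 + s + w2)); first by move: ys; lra.
exact: H kc W1 Ws W2 D1 D2.
Qed.

End Normalized.

(** * Transience bounds *)

Section WeakCSR.
Variables (R : realType) (d : nat) (A : 'M[rmax R]_d).
Hypothesis irrA : Defs.irreducible A.
Hypothesis d_gt0 : (0 < d)%N.

Local Notation lam := (max_cycle_mean A).
Local Notation N := (normalized A).
Local Notation gam := (graph_cyclicity A).
Local Notation sig := (crit_cyclicity A).
Local Notation crit := (crit_arc A).
Local Notation q := (d %/ gam)%N.
Local Notation r := (d %% gam)%N.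

Lemma crit_girth_bounds k : k \in crit_nodes A -> exists h,
  [/\ girth crit (scc crit k) = (h * gam)%N, (0 < h)%N & (h <= q)%N].
Proof.
move=> /crit_component_cycle[n /girth_attained Kg].
have /andP[g0 gd] := has_cycle_len_bound Kg; rewrite card_ord in gd.
have /has_cycle_lenP[c [cc _ sc]] := Kg.
have /andP[gam0 _] := graph_cyclicity_bounds irrA d_gt0.
have [z [zeta [_ z_eq _ z_walk _]]] := cycle_unroll (wgt N) cc.
have := z_walk 0%N (size c); rewrite add0n (_ : z (size c) = z 0%N); last first.
  by apply/eqP; rewrite z_eq modnn mod0n.
move=> /(crit_walk (@crit_arcP _ _ A)) /graph_cyclicity_dvd; rewrite sc => /dvdnP[h gE].
exists h; rewrite gE in g0 gd *; split => //; last by rewrite leq_divRL.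
by case: (h) g0.
Qed.

Lemma crit_walk_power t i j k l n1 n2 w1 w2 s :
  k \in crit_nodes A -> mxwalk N i k n1 w1 -> walk crit (wgt N) k l t s ->
  mxwalk N l j n2 w2 -> (sig %| n1)%N -> (sig %| n2)%N ->
  let g := girth crit (scc crit k) in
  (g * q + d <= t + 2 * g)%N \/
  [/\ g = (gam * q)%N, (1 < q)%N & (gam * ((q - 1) ^ 2 + 1) + r <= t)%N] ->
  below (w1 + s + w2) ((N ^+ t) i j).
Proof.
move=> kc W1 Ws W2 D1 D2 g tg.
have cP := @crit_arcP _ _ A.
have cle := @normalized_closed_walk_le0 _ _ A; have cdvd := @graph_cyclicity_dvd _ _ A.
have cconn := irreducible_walk irrA.
have /andP[gam0 _] := graph_cyclicity_bounds irrA d_gt0.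
have [h [gE h0 hq]] := crit_girth_bounds kc; rewrite -/g in gE.
have g0 : (0 < g)%N by rewrite gE muln_gt0 h0.
have [n /girth_attained /has_cycle_lenP[c [cc cK sc]]] := crit_component_cycle kc.
have [z [zeta [zin z_eq _ z_walk _]]] := cycle_unroll (wgt N) cc.
rewrite sc -/g gE in z_eq.
have zetaD u : zeta (u + h * gam)%N = zeta u.
  have := z_walk u (h * gam)%N; have -> : z (u + h * gam)%N = z u by apply/eqP; rewrite z_eq modnDr.
  by move=> /(crit_closed cle cP) /eqP; rewrite subr_eq0 => /eqP.
have Nz u m := crit_walk cP (z_walk u m).
have := cK _ (zin 0%N); rewrite inE => /andP[].
move=> /(connect_walk (wgt N))[a1 [p1 P1]] /(connect_walk (wgt N))[a2 [p2 P2]].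
have p12 : p1 + p2 = 0 := crit_closed cle cP (walk_cat P1 P2).
(* This closed critical walk compensates [n1 + n2] modulo [g]; it exists because the cyclicity of
   the component divides [sig], which divides [n1 + n2]. *)
have Hmod : exists n0 w0, walk crit (wgt N) k k n0 w0 /\ n0 = g.-1 * (n1 + n2) %[mod g].
  apply: closed_walk_mod => //.
  apply: dvdn_mull; apply: dvdn_trans (scc_cyclicity_dvd_crit kc) _; exact: dvdn_add.
have [n0 [w0 [W0 n0E]]] := Hmod.
have w00 := crit_closed cle cP W0.
have Wl := walk_cat W1 (crit_walk cP (walk_cat W0 P1)).
(* With [g.-1] further round trips to the shortest cycle, the access paths contribute a multiple of
   [g] to the length, and nothing to the weight. *)
have Wr := walk_cat (crit_walk cP (walk_cat P2 (walk_cat (walk_rep g.-1 (walk_cat P1 P2)) Ws))) W2.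
set L1 := (_ + _)%N in Wl; set L2 := (_ + _)%N in Wr.
have LE : (L1 + L2 = t %[mod h * gam])%N.
  rewrite -gE (_ : _ + _ = g * (a1 + a2) + (n0 + (n1 + n2) + t))%N; last first.
    by rewrite /L1 /L2 -{2}(prednK g0); lia.
  have E : n0 + (n1 + n2) = 0 %[mod g].
    by rewrite -modnDml n0E modnDml addnC -mulSn prednK // modnMr mod0n.
  by rewrite [(g * _)%N]mulnC modnMDl -modnDml E mod0n add0n.
apply/below_pow.
suff [w lw Hw] : exists2 w, w1 + (w0 + p1) + (p2 + ((p1 + p2) *+ g.-1 + s) + w2) <= w & mxwalk N i j t w.
  exists w => //; apply: le_trans lw; rewrite p12 mul0rn w00; move: p12; lra.
have dE : #|'I_d| = (gam * q + r)%N by rewrite card_ord mulnC -divn_eq.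
have rg : (r < gam)%N by rewrite ltn_mod.
case: tg => [tg|[gq q1 tg]].
  by apply: (walk_through_cycle gam0 cle cdvd cconn h0 z_eq Nz zetaD Wl Wr LE dE rg); rewrite card_ord -gE.
have hE : h = q by apply/eqP; rewrite -(eqn_pmul2r gam0) -gE gq mulnC.
have hE2 : h = (q - 2).+2 by rewrite hE; clear - q1; lia.
apply: (walk_through_long_cycle gam0 cle cdvd cconn h0 z_eq Nz zetaD hE2 Wl Wr LE _ rg).
  by rewrite hE.
by rewrite (_ : (q - 2).+1 = q - 1)%N //; clear - q1; lia.
Qed.

Local Notation NB := (Fin (- lam) *: nachtigall A).

Lemma arc_nachtigall i j : arc NB i j =
  [&& i \notin crit_nodes A, j \notin crit_nodes A & arc N i j].
Proof. by rewrite /arc !mxE; case: (i \in _) => //=; case: (j \in _). Qed.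

Lemma wgt_nachtigall i j : arc NB i j -> wgt NB i j = wgt N i j.
Proof. by rewrite /arc /wgt !mxE; case: ifP. Qed.

Lemma nachtigall_below i j t w : below w ((NB ^+ t) i j) -> below w ((N ^+ t) i j).
Proof.
rewrite !below_pow => -[v wv Hv]; exists v => //; move: Hv.
apply: walk_mono => x y xy; rewrite wgt_nachtigall //; split => //.
by move: xy; rewrite arc_nachtigall => /and3P[].
Qed.

(** A walk meeting a critical node is dominated by the CSR term; any other walk uses only arcs of
    the Nachtigall matrix. *)
Lemma pow_below_csr i j t w : below w ((N ^+ t) i j) ->
  below w (csr A t i j) || below w ((NB ^+ t) i j).
Proof.
move=> /below_pow[v wv [f [f0 fn fe vE]]].
have [/existsP[p pc]|/existsPn nc] := boolP [exists p : 'I_t.+1, f p \in crit_nodes A].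
  have lp : (p <= t)%N by rewrite -ltnS.
  have := csr_walk irrA pc (subwalk (wgt N) fe (leq0n p) lp) (subwalk (wgt N) fe lp (leqnn t)).
  rewrite -(big_cat_nat (leq0n p) lp) /= -vE subn0 subnKC // f0 fn.
  by move=> /(below_le wv) ->.
apply/orP; right; apply/below_pow; exists v => //.
have NBe p : (p < t)%N -> arc NB (f p) (f p.+1).
  move=> lp; rewrite arc_nachtigall fe // andbT.
  by have := nc (Ordinal (leqW lp)); have := nc (Ordinal (lp : (p.+1 < t.+1)%N)) => /= -> ->.
exists f; split => //; rewrite vE; apply: eq_big_nat => p /andP[_ lp].
by rewrite wgt_nachtigall // NBe.
Qed.

Lemma weak_csr_fromP T :
  (forall t, (T <= t)%N -> forall k, k \in crit_nodes A -> let g := girth crit (scc crit k) in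
    (g * q + d <= t + 2 * g)%N \/
    [/\ g = (gam * q)%N, (1 < q)%N & (gam * ((q - 1) ^ 2 + 1) + r <= t)%N]) ->
  weak_csr_from A T.
Proof.
move=> HT t lt.
have lam1 : Fin lam * Fin (- lam) = 1 :> rmax R by congr Some; exact: subrr.
have AE : A = Fin lam *: N by rewrite scalerA lam1 scale1r.
have BE : nachtigall A = Fin lam *: NB by rewrite scalerA lam1 scale1r.
rewrite [in LHS]AE [in X in _ + X]BE (scale_pow N) (scale_pow NB) -scalerDr; congr (_ *: _).
apply/matrixP => i j; rewrite [RHS]mxE; apply: below_inj => w; rewrite belowD; split.
  exact: pow_below_csr.
case/orP; last exact: nachtigall_below.
apply: csr_below => k l n1 n2 w1 w2 s kc W1 Ws W2 D1 D2.
exact: crit_walk_power kc W1 Ws W2 D1 D2 (HT t lt k kc).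
Qed.

(** * The two thresholds *)

Local Notation gmax := (max_crit_girth A).

Lemma cyclicity_quotient_gt0 : (0 < q)%N.
Proof.
have /andP[gam0 gamd] := graph_cyclicity_bounds irrA d_gt0.
by rewrite divn_gt0.
Qed.

Lemma weak_csr_wielandt : weak_csr_from A (gam * Wi q + r).
Proof.
apply: weak_csr_fromP => t lt k kc g.
have [h [gE h0 hq]] := crit_girth_bounds kc; rewrite -/g in gE.
have dE : d = (q * gam + r)%N by exact: divn_eq.
have q0 := cyclicity_quotient_gt0.
move: lt; rewrite /Wi; case: ltnP => q1 lt.
  move: hq; rewrite leq_eqVlt => /predU1P[hqE|hq].
    by right; rewrite gE hqE mulnC.
  (* For h at most q - 1, h(q - 2) + q is at most (q - 1)(q - 2) + q = (q - 1)^2 + 1. *)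
  left; rewrite gE.
  suff : (h * gam * q + (q * gam + r) <= t + 2 * (h * gam))%N by rewrite -dE.
  move: lt hq q1; clear.
  case: (q) => [|[|m]] // + lhm _; rewrite ltnS in lhm.
  have := leq_mul (leqnn gam) (leq_mul lhm (leqnn m)); rewrite subn1 /=; nia.
(* Here [q] and [h] are 1, and both conditions reduce to [r <= t]. *)
left; have q1E : q = 1%N by lia.
have h1 : h = 1%N by lia.
by rewrite q1E mul1n in dE; rewrite gE h1 q1E; clear - lt dE; lia.
Qed.

Lemma max_crit_girth_le : (gmax <= gam * q)%N.
Proof.
apply/bigmax_leqP => K /imsetP[k kc ->]; have [h [-> _ hq]] := crit_girth_bounds kc.
by rewrite mulnC leq_mul2l hq orbT.
Qed.

(** The quantity g(q - 2) + d does not decrease with g when q is at least 2; for q = 1 every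
    critical girth equals [gam]. *)
Lemma weak_csr_girth : weak_csr_from A (gmax * q + d - 2 * gmax).
Proof.
apply: weak_csr_fromP => t lt k kc g; left.
have [h [gE h0 hq]] := crit_girth_bounds kc; rewrite -/g in gE.
have gle : (g <= gmax)%N.
  by apply: (leq_bigmax_cond (F := girth crit)); exact: imset_f.
have gm := max_crit_girth_le; have q0 := cyclicity_quotient_gt0.
have [q1|q1] := leqP q 1.
  have q1E : q = 1%N by lia.
  have h1 : h = 1%N by lia.
  by rewrite q1E muln1 in lt gm *; rewrite gE h1 mul1n in gle *; clear - lt gm gle; lia.
move: lt; rewrite -(subnKC gle); move: (gmax - g)%N => x lt.
have : (x * 2 <= x * q)%N by rewrite leq_mul2l q1 orbT.
by clear - lt; lia.
Qed.

(** Ensures that the truncated difference in the girth threshold is the true one in [int]. *)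
Lemma max_crit_girth_bound : (2 * gmax <= gmax * q + d)%N.
Proof.
have gm := max_crit_girth_le; have q0 := cyclicity_quotient_gt0.
have dE : (gam * q <= d)%N by rewrite mulnC leq_divM.
have [q1|q1] := leqP q 1.
  have q1E : q = 1%N by lia.
  by rewrite q1E in gm dE *; clear - gm dE; lia.
by rewrite mulnC (leq_trans _ (leq_addr _ _)) // leq_mul2l q1 orbT.
Qed.

End WeakCSR.

(* The bound (ii) is stated in [int]: the difference may be negative. *)
Theorem theorem3p2 (R : realType) (d : nat) (A : 'M[rmax R]_d)
    (hd : (0 < d)%N) (irrA : irreducible A) :
  exists2 T1N : nat, is_T1N A T1N &
    let gam := graph_cyclicity A in
    let g := max_crit_girth A in
    (T1N <= gam * Wi (d %/ gam) + d %% gam)%N /\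
    T1N%:Z <= g%:Z * ((d %/ gam)%N%:Z - 2) + d%:Z.
Proof.
have T1ex : exists T, `[< weak_csr_from A T >].
  by eexists; apply/asboolP; exact: weak_csr_girth irrA hd.
case: (ex_minnP T1ex) => T /asboolP TA Tmin; exists T.
  by split => // T' /asboolP /Tmin.
have /asboolP/Tmin T1 := weak_csr_wielandt irrA hd.
have /asboolP/Tmin T2 := weak_csr_girth irrA hd.
have G := max_crit_girth_bound irrA hd.
split=> //; move: T2 G; clear; set g := max_crit_girth A; set m := (d %/ _)%N.
move=> T2 G; rewrite mulrBr -!PoszM addrAC; lia.
Qed.
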